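(* Let $a_n$ ($n\ge1$) be the coefficients in the expansion $W(e^t)=\omega_0+\sum_{n=1}^\infty a_nt^n$ about $t=0$ (equivalently, $W(x)=\omega_0+\sum_{n\ge1}a_n(\ln x)^n$). Then $$a_n\sim\sqrt{\frac{2}{\pi}}\;\frac{(-1)^n\sin\left(\frac{2n-1}{2}\arctan\pi\right)}{n^{\frac32}(1+\pi^2)^{\frac{2n-1}{4}}}\qquad\text{as } n\to\infty.$$
   Context: $W$ is the principal branch of the Lambert $W$ function and $\omega_0=W(1)=0.56714329\ldots$. Here ''$\sim$'' is used in the sense of Darboux's theorem for oscillating coefficients: the difference of the two sides is $o\left(n^{-3/2}(1+\pi^2)^{-n/2}\right)$. *)

(* Defs.v *)
From Stdlib Require Import Reals.
From Coquelicot Require Import Coquelicot.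
Open Scope R_scope.

(* The principal branch of the Lambert W function on its real domain
   [-1/e, +oo): the unique w >= -1 with w e^w = x.  The value is meaningless
   for x < -1/e, where no such w exists. *)
Definition LambertW (x : R) : R :=
  iota (fun w : R => -1 <= w /\ w * exp w = x).

Definition omega0 : R := LambertW 1.

(* W(e^t) = omega0 + sum_{n >= 1} a_n t^n, the series converging to that value
   for every t in a neighbourhood of 0.  The entry a 0 is not used. *)
Definition is_W_exp_expansion (a : nat -> R) : Prop :=
  locally 0 (fun t : R =>
    is_series (fun k : nat => a (S k) * t ^ (S k)) (LambertW (exp t) - omega0)).

Definition W_exp_main_term (n : nat) : R :=
  sqrt (2 / PI) *
  ((-1) ^ n * sin ((2 * INR n - 1) / 2 * atan PI) /
   (Rpower (INR n) (3 / 2) * Rpower (1 + PI ^ 2) ((2 * INR n - 1) / 4))).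

(* In Coquelicot, [is_domin F f g] reads "g = o(f) along F".  A plain ratio
   u n / v n -> 1 is not meant here, because the main term oscillates. *)
Definition darboux_sim (u v : nat -> R) : Prop :=
  is_domin eventually
    (fun n : nat => Rpower (INR n) (- (3 / 2)) * Rpower (1 + PI ^ 2) (- (INR n / 2)))
    (fun n : nat => u n - v n).

(* Main.v *)
Require Import Defs.
From Stdlib Require Import Reals Lra Lia Psatz.
From Coquelicot Require Import Coquelicot.
Open Scope R_scope.

(** The function [f(t) = W(e^t)] satisfies [f + ln f = t], hence
    [f' = 1 - 1 / (1 + f)].  With [w = f(t)], the number [1 / (1 + w)] is the residue
    of [1 / (z + e^z - t)] at its only zero [ln w] in the strip [|Im z| <= PI], and
    shifting the line of integration from the real axis to [Im z = PI] gives
    [1 / (1 + w)] as the integral over the real line of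
    [1 / ((e^x - x + t)^2 + PI^2)] ([sym_integral_Lambert_kernel]).  The shift is a
    differentiation under the integral sign followed by the Cauchy-Riemann
    equations ([is_derive_RInt_Im_analytic]).

    That integrand is [Im (1 / (k + t)) / PI] with [k(x) = e^x - x - i PI].
    Expanding in powers of [t] and comparing power series, for [n >= 2],
    [n a_n = (-1)^n / PI * int Im (k^(-n))] ([Lambert_coeff]).  Here [|k|] is minimal
    at [x = 0], where [k = 1 - i PI + x^2 / 2 + O(x^3)], so Laplace's method applies:
    replacing [k] by its quadratic part changes the integral by
    [O(n^(-1) (1 + PI^2)^(-n/2))] ([kernel_moment_close]).

    The model integrals [int (1 - i PI + x^2 / 2)^(-n)] are computed exactly by
    integration by parts from their value at [n = 1] ([c_sym_integral_model]).  They
    are powers of [1 - i PI] times central binomial coefficients over powers of [4],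
    for which Wallis's bounds give [1 / sqrt (PI n)] ([wallis_sqrt]).  The argument of
    [(1 - i PI)^(1/2 - n)] is [(n - 1/2) atan PI], which produces the sine in the main
    term; the two errors are [O(n^(-2) (1 + PI^2)^(-n/2))] in [a_n]
    ([coefficient_error]). *)

(** * Complex-valued functions of real variables *)

Definition c_derive (F : R -> C) (x : R) (l : C) : Prop :=
  is_derive (fun t => Re (F t)) x (Re l) /\
  is_derive (fun t => Im (F t)) x (Im l).

Lemma c_derive_ext (F G : R -> C) (x : R) (l : C) :
  (forall t, F t = G t) -> c_derive F x l -> c_derive G x l.
Proof.
  intros E [H1 H2]; split.
  - apply is_derive_ext with (fun t => Re (F t)); [intros; now rewrite E | exact H1].
  - apply is_derive_ext with (fun t => Im (F t)); [intros; now rewrite E | exact H2].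
Qed.

Lemma c_derive_val (F : R -> C) (x : R) (l l' : C) :
  c_derive F x l -> l = l' -> c_derive F x l'.
Proof. now intros H <-. Qed.

Lemma c_derive_const (c : C) (x : R) : c_derive (fun _ => c) x 0.
Proof. split; simpl; auto_derive; trivial. Qed.

Lemma c_derive_real (f : R -> R) (x l : R) :
  is_derive f x l -> c_derive (fun t => RtoC (f t)) x (RtoC l).
Proof. intros H; split; simpl; [exact H | auto_derive; trivial]. Qed.

Lemma c_derive_plus (F G : R -> C) (x : R) (l m : C) :
  c_derive F x l -> c_derive G x m -> c_derive (fun t => (F t + G t)%C) x (l + m)%C.
Proof.
  intros [H1 H2] [K1 K2]; split; simpl.
  - now apply (is_derive_plus (fun t => Re (F t)) (fun t => Re (G t))).
  - now apply (is_derive_plus (fun t => Im (F t)) (fun t => Im (G t))).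
Qed.

Lemma c_derive_mult (F G : R -> C) (x : R) (l m : C) :
  c_derive F x l -> c_derive G x m ->
  c_derive (fun t => (F t * G t)%C) x (l * G x + F x * m)%C.
Proof.
  intros [H1 H2] [K1 K2]; split; simpl.
  - eapply is_derive_ext with (fun t => Re (F t) * Re (G t) - Im (F t) * Im (G t)).
    { reflexivity. }
    evar_last.
    apply (is_derive_minus (V := R_NormedModule) (fun t => Re (F t) * Re (G t))).
    + apply (is_derive_mult _ _ x _ _ H1 K1). intros; apply Rmult_comm.
    + apply (is_derive_mult _ _ x _ _ H2 K2). intros; apply Rmult_comm.
    + unfold minus, plus, opp, mult; simpl. unfold Re, Im. ring.
  - eapply is_derive_ext with (fun t => Re (F t) * Im (G t) + Im (F t) * Re (G t)).
    { reflexivity. }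
    evar_last.
    apply (is_derive_plus (V := R_NormedModule) (fun t => Re (F t) * Im (G t))).
    + apply (is_derive_mult _ _ x _ _ H1 K2). intros; apply Rmult_comm.
    + apply (is_derive_mult _ _ x _ _ H2 K1). intros; apply Rmult_comm.
    + unfold plus, mult; simpl. unfold Re, Im. ring.
Qed.

Lemma C_neq_0_norm (z : C) : z <> RtoC 0 -> Re z ^ 2 + Im z ^ 2 <> 0.
Proof.
  intros Hz E. apply Hz. apply Cmod_eq_0. 
  rewrite <- Cmod2_alt in E. destruct (Req_dec (Cmod z) 0) as [|H]; trivial.
  exfalso; revert E; now apply pow_nonzero.
Qed.

Lemma is_derive_inv_components (f g : R -> R) (x l m : R) :
  is_derive f x l -> is_derive g x m -> f x ^ 2 + g x ^ 2 <> 0 ->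
  is_derive (fun t => f t / (f t ^ 2 + g t ^ 2)) x
    ((l * (g x ^ 2 - f x ^ 2) - 2 * f x * g x * m) / (f x ^ 2 + g x ^ 2) ^ 2) /\
  is_derive (fun t => - g t / (f t ^ 2 + g t ^ 2)) x
    ((m * (g x ^ 2 - f x ^ 2) + 2 * f x * g x * l) / (f x ^ 2 + g x ^ 2) ^ 2).
Proof.
  intros H1 H2 Hn.
  assert (E1 := is_derive_unique _ _ _ H1). assert (E2 := is_derive_unique _ _ _ H2).
  assert (X1 : ex_derive f x) by now exists l.
  assert (X2 : ex_derive g x) by now exists m.
  assert (Hn' : f x * (f x * 1) + g x * (g x * 1) <> 0).
  { intros E; apply Hn; rewrite <- E; ring. }
  split; auto_derive; try (repeat split; trivial).
  - change (Derive (fun x => f x) x) with (Derive f x).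
    change (Derive (fun x => g x) x) with (Derive g x).
    rewrite E1, E2. field. exact Hn.
  - change (Derive (fun x => f x) x) with (Derive f x).
    change (Derive (fun x => g x) x) with (Derive g x).
    rewrite E1, E2. field. exact Hn.
Qed.

Lemma c_derive_inv (F : R -> C) (x : R) (l : C) :
  c_derive F x l -> F x <> RtoC 0 ->
  c_derive (fun t => (/ F t)%C) x (- l / (F x * F x))%C.
Proof.
  intros [H1 H2] Hz. pose proof (C_neq_0_norm _ Hz) as Hn.
  destruct (is_derive_inv_components _ _ _ _ _ H1 H2 Hn) as [K1 K2].
  assert (E : (- l / (F x * F x))%C = (- l * (/ F x * / F x))%C) by now field.
  rewrite E; clear E H1 H2.
  split.
  - refine (eq_rect _ (fun d => is_derive _ x d) K1 _ _).
    destruct (F x) as [a b]; destruct l as [c d]; unfold Cinv, Cmult, Copp;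
      unfold Re, Im in *; simpl in *.
    field. intros E; apply Hn; rewrite <- E; ring.
  - refine (eq_rect _ (fun d => is_derive _ x d) K2 _ _).
    destruct (F x) as [a b]; destruct l as [c d]; unfold Cinv, Cmult, Copp;
      unfold Re, Im in *; simpl in *.
    field. intros E; apply Hn; rewrite <- E; ring.
Qed.

Lemma c_derive_pow (F : R -> C) (x : R) (l : C) (n : nat) :
  c_derive F x l ->
  c_derive (fun t => (F t ^ n)%C) x (INR n * F x ^ pred n * l)%C.
Proof.
  intros H; induction n as [|n IH].
  - apply (c_derive_val (fun _ => RtoC 1) _ 0); [apply c_derive_const|].
    change (INR 0) with 0. ring.
  - apply c_derive_ext with (fun t => (F t * F t ^ n)%C); [intros; now rewrite Cpow_S|].
    apply (c_derive_val _ _ _ _ (c_derive_mult _ _ _ _ _ H IH)).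
    rewrite S_INR, RtoC_plus. destruct n as [|n]; cbn [pred].
    + change (INR 0) with 0. change (F x ^ 0)%C with (RtoC 1). ring.
    + rewrite Cpow_S. ring.
Qed.

Definition c_continuous (F : R -> C) : Prop :=
  (forall x, continuous (fun t => Re (F t)) x) /\
  (forall x, continuous (fun t => Im (F t)) x).

Lemma c_derive_continuous (F : R -> C) :
  (forall x, exists l, c_derive F x l) -> c_continuous F.
Proof.
  intros H; split; intros x; destruct (H x) as [l Hl].
  - apply (ex_derive_continuous (V := R_NormedModule)). exists (Re l). apply Hl.
  - apply (ex_derive_continuous (V := R_NormedModule)). exists (Im l). apply Hl.
Qed.

Definition c_continuous_2d (F : R -> R -> C) (x y : R) : Prop :=
  continuity_2d_pt (fun u v => Re (F u v)) x y /\
  continuity_2d_pt (fun u v => Im (F u v)) x y.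

Lemma c_continuous_2d_plus (F G : R -> R -> C) (x y : R) :
  c_continuous_2d F x y -> c_continuous_2d G x y ->
  c_continuous_2d (fun u v => (F u v + G u v)%C) x y.
Proof.
  intros [H1 H2] [K1 K2]; split; simpl.
  - now apply (continuity_2d_pt_plus (fun u v => Re (F u v))).
  - now apply (continuity_2d_pt_plus (fun u v => Im (F u v))).
Qed.

Lemma c_continuous_2d_opp (F : R -> R -> C) (x y : R) :
  c_continuous_2d F x y -> c_continuous_2d (fun u v => (- F u v)%C) x y.
Proof.
  intros [H1 H2]; split; simpl.
  - now apply (continuity_2d_pt_opp (fun u v => Re (F u v))).
  - now apply (continuity_2d_pt_opp (fun u v => Im (F u v))).
Qed.

Lemma c_continuous_2d_mult (F G : R -> R -> C) (x y : R) :
  c_continuous_2d F x y -> c_continuous_2d G x y ->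
  c_continuous_2d (fun u v => (F u v * G u v)%C) x y.
Proof.
  intros [H1 H2] [K1 K2]; split; simpl.
  - apply continuity_2d_pt_minus; now apply continuity_2d_pt_mult.
  - apply continuity_2d_pt_plus; now apply continuity_2d_pt_mult.
Qed.

Lemma c_continuous_2d_inv (F : R -> R -> C) (x y : R) :
  c_continuous_2d F x y -> F x y <> RtoC 0 ->
  c_continuous_2d (fun u v => (/ F u v)%C) x y.
Proof.
  intros [H1 H2] Hz. pose proof (C_neq_0_norm _ Hz) as Hn.
  assert (Hd : continuity_2d_pt (fun u v => / (Re (F u v) ^ 2 + Im (F u v) ^ 2)) x y).
  { apply continuity_2d_pt_inv; [|exact Hn].
    apply continuity_2d_pt_plus.
    - apply continuity_2d_pt_ext with (fun u v => Re (F u v) * Re (F u v));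
        [intros; ring | now apply continuity_2d_pt_mult].
    - apply continuity_2d_pt_ext with (fun u v => Im (F u v) * Im (F u v));
        [intros; ring | now apply continuity_2d_pt_mult]. }
  split.
  - apply (continuity_2d_pt_mult _ _ _ _ H1 Hd).
  - apply (continuity_2d_pt_mult (fun u v => - Im (F u v))); [|exact Hd].
    now apply continuity_2d_pt_opp.
Qed.

(** * Contour shifting in a strip *)

Lemma locally_open_interval (c d y : R) :
  c < y < d -> locally y (fun v => c < v < d).
Proof.
  intros Hy.
  assert (He : 0 < Rmin (y - c) (d - y)) by (apply Rmin_pos; lra).
  exists (mkposreal _ He); intros v Hv.
  apply Rabs_lt_between' in Hv; simpl in Hv.
  pose proof (Rmin_l (y - c) (d - y)); pose proof (Rmin_r (y - c) (d - y)); lra.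
Qed.

Lemma locally_2d_open_box (a b c d x y : R) :
  a < x < b -> c < y < d -> locally_2d (fun u v => a < u < b /\ c < v < d) x y.
Proof.
  intros Hx Hy.
  destruct (locally_open_interval _ _ _ Hx) as [e1 H1].
  destruct (locally_open_interval _ _ _ Hy) as [e2 H2].
  assert (He : 0 < Rmin e1 e2) by (apply Rmin_pos; apply cond_pos).
  exists (mkposreal _ He); intros u v Hu Hv; simpl in *.
  split; [apply H1 | apply H2].
  - apply Rlt_le_trans with (1 := Hu); apply Rmin_l.
  - apply Rlt_le_trans with (1 := Hv); apply Rmin_r.
Qed.

(** The Cauchy--Riemann equations turn the [y]-derivative of [Im F] into the
    [u]-derivative of [Re F], which integrates to boundary terms. *)
Lemma is_derive_RInt_Im_analytic (F F' : R -> R -> C) (a' a b b' c d y : R) :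
  a' < a -> a <= b -> b < b' -> c < y < d ->
  (forall u v, a' < u < b' -> c < v < d ->
     c_derive (fun s => F s v) u (F' u v) /\
     c_derive (fun s => F u s) v (Ci * F' u v)%C /\
     c_continuous_2d F' u v) ->
  is_derive (fun v => RInt (fun u => Im (F u v)) a b) y
    (Re (F b y) - Re (F a y)).
Proof.
  intros Ha Hab Hb Hy HF.
  assert (HD : forall u v, a' < u < b' -> c < v < d ->
            is_derive (fun s => Im (F u s)) v (Re (F' u v))).
  { intros u v Hu Hv. destruct (HF u v Hu Hv) as [_ [[_ H] _]].
    refine (eq_rect _ (fun l => is_derive _ v l) H _ _). simpl. unfold Re, Im; ring. }
  assert (Hc : forall u, a <= u <= b -> continuity_2d_pt (fun v u => Re (F' u v)) y u).
  { intros u Hu. destruct (HF u y) as [_ [_ [H _]]]; [lra | lra |].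
    intros eps. destruct (H eps) as [del Hdel]. exists del. intros p q Hp Hq. now apply Hdel. }
  replace (Re (F b y) - Re (F a y))
    with (RInt (fun u => Derive (fun v => Im (F u v)) y) a b).
  - apply (is_derive_RInt_param (fun v u => Im (F u v))).
    + apply filter_imp with (2 := locally_open_interval _ _ _ Hy).
      intros v Hv u Hu. rewrite Rmin_left, Rmax_right in Hu by lra.
      exists (Re (F' u v)). apply HD; lra.
    + rewrite Rmin_left, Rmax_right by lra. intros u Hu.
      apply continuity_2d_pt_ext_loc with (2 := Hc u Hu).
      assert (Hu' : a' < u < b') by lra.
      destruct (locally_2d_open_box _ _ _ _ _ _ Hy Hu') as [e He].
      exists e; intros v s Hv Hs. destruct (He v s Hv Hs) as [K1 K2].
      symmetry; apply is_derive_unique, HD; trivial.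
    + apply filter_imp with (2 := locally_open_interval _ _ _ Hy).
      intros v Hv. apply (ex_RInt_continuous (V := R_CompleteNormedModule)).
      rewrite Rmin_left, Rmax_right by lra. intros u Hu.
      apply (ex_derive_continuous (V := R_NormedModule)).
      exists (Im (F' u v)). apply (HF u v); lra.
  - apply is_RInt_unique.
    apply is_RInt_ext with (fun u => Re (F' u y)).
    { rewrite Rmin_left, Rmax_right by lra. intros u Hu.
      symmetry; apply is_derive_unique, HD; lra. }
    apply (is_RInt_derive (fun u => Re (F u y))).
    + rewrite Rmin_left, Rmax_right by lra. intros u Hu. apply (HF u y); lra.
    + rewrite Rmin_left, Rmax_right by lra. intros u Hu.
      apply continuity_pt_filterlim.
      intros eps Heps.
      destruct (Hc u Hu (mkposreal _ Heps)) as [del Hdel].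
      exists del. split; [apply cond_pos|]. intros s [_ Hs].
      apply Hdel; [|exact Hs]. rewrite Rminus_diag, Rabs_R0. apply cond_pos.
Qed.

Definition cexp (u y : R) : C := (exp u * cos y, exp u * sin y).

Definition strip_den (w u y : R) : C := ((u, y) + w * (cexp u y - 1))%C.

(** At [z = u + i y] this is [z / (z + w (e^z - 1))].  The denominator is
    [zeta + e^zeta - t] for [t = w + ln w], written at [zeta = z + ln w]; its only
    zero with [|Im z| <= PI] is [z = 0], simple of derivative [1 + w], and the
    numerator removes that pole. *)
Definition strip_fun (w u y : R) : C := ((u, y) * / strip_den w u y)%C.

Definition strip_fun' (w u y : R) : C :=
  (/ strip_den w u y +
   (u, y) * (- (1 + w * cexp u y) * (/ strip_den w u y * / strip_den w u y)))%C.

Lemma strip_den_neq_0 (w u y : R) :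
  0 < y + w * exp u * sin y -> strip_den w u y <> RtoC 0.
Proof.
  intros H E. apply (f_equal Im) in E. unfold strip_den, cexp in E; simpl in E. nra.
Qed.

Lemma c_derive_strip_fun_u (w u y : R) : strip_den w u y <> RtoC 0 ->
  c_derive (fun s => strip_fun w s y) u (strip_fun' w u y).
Proof.
  intros H.
  assert (Hz : c_derive (fun s => (s, y)) u 1) by (split; simpl; auto_derive; trivial).
  assert (He : c_derive (fun s => cexp s y) u (cexp u y)).
  { split; unfold cexp; simpl; auto_derive; trivial; unfold Re, Im; simpl; ring. }
  assert (Hd : c_derive (fun s => strip_den w s y) u (1 + w * cexp u y)%C).
  { eapply c_derive_val.
    - apply c_derive_plus; [exact Hz|].
      apply c_derive_mult; [apply c_derive_const|].
      apply c_derive_plus; [exact He | apply c_derive_const].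
    - cbv beta. ring. }
  eapply c_derive_val.
  - apply c_derive_mult; [exact Hz|]. apply c_derive_inv; [exact Hd | exact H].
  - unfold strip_fun'. now field.
Qed.

Lemma c_derive_strip_fun_y (w u y : R) : strip_den w u y <> RtoC 0 ->
  c_derive (fun s => strip_fun w u s) y (Ci * strip_fun' w u y).
Proof.
  intros H.
  assert (Hz : c_derive (fun s => (u, s)) y Ci) by (split; simpl; auto_derive; trivial).
  assert (He : c_derive (fun s => cexp u s) y (Ci * cexp u y)%C).
  { split; unfold cexp; simpl; auto_derive; trivial; unfold Re, Im; simpl; ring. }
  assert (Hd : c_derive (fun s => strip_den w u s) y (Ci * (1 + w * cexp u y))%C).
  { eapply c_derive_val.
    - apply c_derive_plus; [exact Hz|].
      apply c_derive_mult; [apply c_derive_const|].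
      apply c_derive_plus; [exact He | apply c_derive_const].
    - cbv beta. ring. }
  eapply c_derive_val.
  - apply c_derive_mult; [exact Hz|]. apply c_derive_inv; [exact Hd | exact H].
  - unfold strip_fun'. now field.
Qed.

Lemma c_continuous_2d_const (c : C) (x y : R) : c_continuous_2d (fun _ _ => c) x y.
Proof. split; apply continuity_2d_pt_const. Qed.

Lemma c_continuous_2d_strip_fun' (w u y : R) : strip_den w u y <> RtoC 0 ->
  c_continuous_2d (strip_fun' w) u y.
Proof.
  intros H.
  assert (Hz : c_continuous_2d (fun s t => (s, t)) u y).
  { split; [apply continuity_2d_pt_id1 | apply continuity_2d_pt_id2]. }
  assert (Hx : continuity_2d_pt (fun s _ => exp s) u y).
  { apply (continuity_1d_2d_pt_comp exp (fun s _ => s)); [|apply continuity_2d_pt_id1].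
    apply derivable_continuous_pt, derivable_pt_exp. }
  assert (He : c_continuous_2d cexp u y).
  { split; apply continuity_2d_pt_mult; try exact Hx.
    - apply (continuity_1d_2d_pt_comp cos (fun _ t => t)); [|apply continuity_2d_pt_id2].
      apply continuity_cos.
    - apply (continuity_1d_2d_pt_comp sin (fun _ t => t)); [|apply continuity_2d_pt_id2].
      apply continuity_sin. }
  assert (Hd : c_continuous_2d (strip_den w) u y).
  { apply c_continuous_2d_plus; [exact Hz|].
    apply c_continuous_2d_mult; [apply c_continuous_2d_const|].
    apply c_continuous_2d_plus; [exact He | apply c_continuous_2d_const]. }
  pose proof (c_continuous_2d_inv _ _ _ Hd H) as Hi.
  apply c_continuous_2d_plus; [exact Hi|].
  apply c_continuous_2d_mult; [exact Hz|].
  apply c_continuous_2d_mult; [|now apply c_continuous_2d_mult].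
  apply c_continuous_2d_opp, c_continuous_2d_plus; [apply c_continuous_2d_const|].
  apply c_continuous_2d_mult; [apply c_continuous_2d_const | exact He].
Qed.

Lemma Im_strip_fun (w u y : R) : strip_den w u y <> RtoC 0 ->
  Im (strip_fun w u y) =
    - w * (u * (exp u * sin y) - y * (exp u * cos y - 1)) /
    (Cmod (strip_den w u y) ^ 2).
Proof.
  intros H. pose proof (C_neq_0_norm _ H) as Hn. rewrite Cmod2_alt.
  change (Im (strip_fun w u y)) with
    (u * (- Im (strip_den w u y) / (Re (strip_den w u y) ^ 2 + Im (strip_den w u y) ^ 2)) +
     y * (Re (strip_den w u y) / (Re (strip_den w u y) ^ 2 + Im (strip_den w u y) ^ 2))).
  assert (Er : Re (strip_den w u y) = u + w * (exp u * cos y - 1)).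
  { unfold strip_den, cexp, Re; simpl. ring. }
  assert (Ei : Im (strip_den w u y) = y + w * (exp u * sin y)).
  { unfold strip_den, cexp, Im; simpl. ring. }
  rewrite Er, Ei in *. field. exact Hn.
Qed.

(** Applied to [s -> f (s x)], this takes the place of Taylor's formula in the
    estimates of the exponential and of the strip function. *)
Lemma MVT_segment (f df : R -> R) :
  (forall s, is_derive f s (df s)) ->
  exists c, 0 <= c <= 1 /\ f 1 - f 0 = df c.
Proof.
  intros H.
  destruct (MVT_gen f 0 1 df) as [c [Hc E]].
  - intros; apply H.
  - intros s _. apply continuity_pt_filterlim.
    apply (ex_derive_continuous (V := R_NormedModule)). exists (df s). apply H.
  - rewrite Rmin_left, Rmax_right in Hc by lra. exists c; split; [lra|]. rewrite E; ring.
Qed.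

Lemma exp_le_compat (x y : R) : x <= y -> exp x <= exp y.
Proof.
  intros [H | ->]; [left; now apply exp_increasing | apply Rle_refl].
Qed.

Lemma exp_scale_le (A u s : R) : Rabs u <= A -> 0 <= s <= 1 -> exp (s * u) <= exp A.
Proof.
  intros HA Hs. apply exp_le_compat. apply Rabs_le_between in HA.
  destruct (Rle_lt_dec 0 u); nra.
Qed.

(** With [h(z) = (e^z - 1) / z], the average of [e^(s z)] over [0 <= s <= 1], the
    next two bounds say [Re h >= 0] and [|Im h| <= y e^A]. *)
Lemma Re_exp_quotient_nonneg (u y : R) : 0 < y <= PI / 2 ->
  0 <= u * (exp u * cos y - 1) + y * (exp u * sin y).
Proof.
  intros Hy. pose proof PI_RGT_0.
  destruct (MVT_segment
    (fun s => u * (exp (s * u) * cos (s * y)) + y * (exp (s * u) * sin (s * y)))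
    (fun s => (u ^ 2 + y ^ 2) * (exp (s * u) * cos (s * y)))) as [c [Hc E]].
  { intros s; auto_derive; trivial; ring. }
  rewrite !Rmult_1_l, !Rmult_0_l, exp_0, cos_0, sin_0 in E.
  assert (0 <= cos (c * y)) by (apply cos_ge_0; nra).
  pose proof (exp_pos (c * u)).
  assert (0 <= (u ^ 2 + y ^ 2) * (exp (c * u) * cos (c * y))).
  { apply Rmult_le_pos; [nra | apply Rmult_le_pos; lra]. }
  lra.
Qed.

Lemma Im_exp_quotient_le (A u y : R) : Rabs u <= A -> 0 < y <= PI / 2 ->
  Rabs (u * (exp u * sin y) - y * (exp u * cos y - 1)) <= (u ^ 2 + y ^ 2) * (exp A * y).
Proof.
  intros HA Hy. pose proof PI_RGT_0.
  destruct (MVT_segment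
    (fun s => u * (exp (s * u) * sin (s * y)) - y * (exp (s * u) * cos (s * y)))
    (fun s => (u ^ 2 + y ^ 2) * (exp (s * u) * sin (s * y)))) as [c [Hc E]].
  { intros s; auto_derive; trivial; ring. }
  rewrite !Rmult_1_l, !Rmult_0_l, exp_0, cos_0, sin_0 in E.
  replace (u * (exp u * sin y) - y * (exp u * cos y - 1))
    with ((u ^ 2 + y ^ 2) * (exp (c * u) * sin (c * y))) by lra.
  assert (0 <= c * y <= y) by nra.
  assert (0 <= sin (c * y)) by (apply sin_ge_0; lra).
  assert (sin (c * y) <= y).
  { destruct (Rle_lt_or_eq_dec 0 (c * y)) as [Hp | He]; [lra | |].
    - pose proof (sin_lt_x _ Hp). lra.
    - rewrite <- He, sin_0. lra. }
  pose proof (exp_pos (c * u)). pose proof (exp_scale_le A u c HA Hc).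
  rewrite Rabs_pos_eq.
  - apply Rmult_le_compat_l; [nra|]. apply Rmult_le_compat; lra.
  - apply Rmult_le_pos; [nra|]. apply Rmult_le_pos; lra.
Qed.

Lemma strip_den_neq_0_strip (w u y : R) : 0 < w -> 0 < y <= PI ->
  strip_den w u y <> RtoC 0.
Proof.
  intros Hw Hy. apply strip_den_neq_0.
  pose proof (exp_pos u). assert (0 <= sin y) by (apply sin_ge_0; lra).
  assert (0 <= w * exp u * sin y); [|lra].
  apply Rmult_le_pos; nra.
Qed.

Lemma Im_strip_fun_small (w A u y : R) : 0 < w -> Rabs u <= A -> 0 < y <= PI / 2 ->
  Rabs (Im (strip_fun w u y)) <= w * exp A * y.
Proof.
  intros Hw HA Hy. pose proof PI_RGT_0.
  assert (Hn : strip_den w u y <> RtoC 0) by (apply strip_den_neq_0_strip; lra).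
  rewrite Im_strip_fun by exact Hn.
  assert (HD : u ^ 2 + y ^ 2 <= Cmod (strip_den w u y) ^ 2).
  { rewrite Cmod2_alt. unfold strip_den, cexp; simpl.
    pose proof (Re_exp_quotient_nonneg u y Hy) as Hr.
    assert (0 <= w * (u * (exp u * cos y - 1) + y * (exp u * sin y)))
      by (apply Rmult_le_pos; lra).
    set (p := exp u * cos y) in *. set (q := exp u * sin y) in *.
    assert (0 <= (w * (p - 1)) ^ 2) by apply pow2_ge_0.
    assert (0 <= (w * q) ^ 2) by apply pow2_ge_0.
    unfold Re, Im; simpl. nra. }
  assert (Hpos : 0 < Cmod (strip_den w u y) ^ 2) by nra.
  unfold Rdiv. rewrite Rabs_mult, Rabs_inv, (Rabs_pos_eq (_ ^ 2)) by lra.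
  apply Rmult_le_reg_r with (Cmod (strip_den w u y) ^ 2); [exact Hpos|].
  rewrite Rmult_assoc, Rinv_l, Rmult_1_r by lra.
  rewrite Rabs_mult, Rabs_Ropp, (Rabs_pos_eq w) by lra.
  pose proof (Im_exp_quotient_le A u y HA Hy) as Hi.
  pose proof (exp_pos A).
  assert (0 <= exp A * y) by nra.
  apply Rle_trans with (w * ((u ^ 2 + y ^ 2) * (exp A * y))).
  - apply Rmult_le_compat_l; lra.
  - replace (w * exp A * y * Cmod (strip_den w u y) ^ 2)
      with (w * (Cmod (strip_den w u y) ^ 2 * (exp A * y))) by ring.
    apply Rmult_le_compat_l; [lra|]. now apply Rmult_le_compat_r.
Qed.

Lemma exp_ge_quadratic (x : R) : 0 <= x -> 1 + x + x ^ 2 / 2 <= exp x.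
Proof.
  intros Hx.
  destruct (MVT_segment (fun s => exp (s * x) - s * x - (s * x) ^ 2 / 2)
    (fun s => x * (exp (s * x) - 1 - s * x))) as [c [Hc E]].
  { intros s; auto_derive; trivial; field. }
  rewrite !Rmult_1_l, !Rmult_0_l, exp_0 in E.
  pose proof (exp_ineq1_le (c * x)). nra.
Qed.

Lemma Cmod_triangle_lower (x y : C) : Cmod x - Cmod y <= Cmod (x + y).
Proof.
  pose proof (Cmod_triangle (x + y) (- y)) as H.
  replace (x + y + - y)%C with x in H by ring. rewrite Cmod_opp in H. lra.
Qed.

Lemma Cmod_cexp (u y : R) : Cmod (cexp u y) = exp u.
Proof.
  unfold Cmod, cexp; simpl. pose proof (exp_pos u).
  transitivity (sqrt (exp u ^ 2)); [f_equal | apply sqrt_pow2; lra].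
  pose proof (sin2_cos2 y) as E. unfold Rsqr in E.
  transitivity (exp u ^ 2 * (sin y * sin y + cos y * cos y)); [ring | rewrite E; ring].
Qed.

Lemma Cmod_pair_le (u y : R) : Cmod (u, y) <= Rabs u + Rabs y.
Proof.
  replace ((u, y) : C) with (RtoC u + Ci * RtoC y)%C.
  - eapply Rle_trans; [apply Cmod_triangle|].
    rewrite Cmod_mult, Cmod_Ci, !Cmod_R. lra.
  - unfold Cplus, Cmult, Ci, RtoC; simpl. f_equal; ring.
Qed.

Lemma strip_fun_right (w eta : R) : 0 < w -> 0 < eta ->
  exists B, 0 < B /\ forall b y, B <= b -> 0 < y <= PI ->
    Rabs (Re (strip_fun w b y)) <= eta.
Proof.
  intros Hw He. pose proof PI_RGT_0.
  exists (PI + 4 * (1 + / eta) / w).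
  assert (Hi : 0 < / eta) by now apply Rinv_0_lt_compat.
  assert (Hp : 0 < 4 * (1 + / eta) / w).
  { apply Rmult_lt_0_compat; [nra | now apply Rinv_0_lt_compat]. }
  split; [lra|]. intros b y Hb Hy.
  apply Rle_trans with (1 := re_le_Cmod _).
  assert (Hz : Cmod (b, y) <= 2 * b).
  { eapply Rle_trans; [apply Cmod_pair_le|]. rewrite !Rabs_pos_eq by lra. lra. }
  assert (Hwb : 4 * (1 + / eta) <= w * b).
  { replace (4 * (1 + / eta)) with (w * (4 * (1 + / eta) / w)) by (field; lra).
    apply Rmult_le_compat_l; lra. }
  assert (Hden : 2 * b / eta <= Cmod (strip_den w b y)).
  { unfold strip_den. rewrite Cplus_comm.
    eapply Rle_trans; [|apply Cmod_triangle_lower].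
    rewrite Cmod_mult, Cmod_R, Rabs_pos_eq by lra.
    pose proof (Cmod_triangle_lower (cexp b y) (- (1))) as Hc.
    rewrite Cmod_opp, Cmod_1, Cmod_cexp in Hc.
    pose proof (exp_ge_quadratic b ltac:(lra)).
    assert (w * (b ^ 2 / 2) <= w * Cmod (cexp b y - 1)).
    { apply Rmult_le_compat_l; [lra|]. unfold Cminus. nra. }
    assert (4 * (1 + / eta) * (b / 2) <= w * b * (b / 2)) by (apply Rmult_le_compat_r; lra).
    unfold Rdiv in *. nra. }
  assert (Hd : 0 < 2 * b / eta) by (apply Rmult_lt_0_compat; lra).
  unfold strip_fun.
  rewrite Cmod_mult, Cmod_inv by (apply strip_den_neq_0_strip; lra).
  apply Rmult_le_reg_r with (Cmod (strip_den w b y)); [lra|].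
  rewrite Rmult_assoc, Rinv_l, Rmult_1_r by lra.
  apply Rle_trans with (1 := Hz).
  replace (2 * b) with (eta * (2 * b / eta)) by (field; lra).
  apply Rmult_le_compat_l; lra.
Qed.

(** [strip_fun] differs from [1] by [w (e^z - 1) / (z + w (e^z - 1))], bounded by
    [2 w / (|a| - 2 w)] far to the left. *)
Lemma strip_fun_left (w eta : R) : 0 < w -> 0 < eta ->
  exists B, 0 < B /\ forall a y, a <= - B -> 0 < y <= PI ->
    Rabs (Re (strip_fun w a y) - 1) <= eta.
Proof.
  intros Hw He.
  exists (2 * w * (1 + / eta)).
  assert (Hi : 0 < / eta) by now apply Rinv_0_lt_compat.
  split; [nra|]. intros a y Ha Hy.
  assert (Hn : strip_den w a y <> RtoC 0) by now apply strip_den_neq_0_strip.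
  assert (E : (strip_fun w a y - 1)%C =
              (- (w * (cexp a y - 1)) * / strip_den w a y)%C).
  { unfold strip_fun. unfold strip_den in *. field. exact Hn. }
  replace (Re (strip_fun w a y) - 1) with (Re (strip_fun w a y - 1)%C)
    by (unfold Re; simpl; ring).
  apply Rle_trans with (1 := re_le_Cmod _). rewrite E; clear E.
  rewrite Cmod_mult, Cmod_inv, Cmod_opp, Cmod_mult, Cmod_R, (Rabs_pos_eq w) by (trivial; lra).
  assert (Hc : w * Cmod (cexp a y - 1) <= 2 * w).
  { pose proof (Cmod_triangle (cexp a y) (- (1))) as Hc.
    rewrite Cmod_opp, Cmod_1, Cmod_cexp in Hc.
    assert (exp a <= 1). { rewrite <- exp_0; apply exp_le_compat. nra. }
    unfold Cminus. nra. }
  assert (Hden : 2 * w * / eta <= Cmod (strip_den w a y)).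
  { unfold strip_den. eapply Rle_trans; [|apply Cmod_triangle_lower].
    rewrite Cmod_mult, Cmod_R, Rabs_pos_eq by lra.
    pose proof (re_le_Cmod (a, y)) as Hr. simpl in Hr. unfold Re in Hr; simpl in Hr.
    rewrite Rabs_left in Hr by nra. nra. }
  assert (Hd : 0 < 2 * w * / eta) by (apply Rmult_lt_0_compat; lra).
  apply Rmult_le_reg_r with (Cmod (strip_den w a y)); [lra|].
  rewrite Rmult_assoc, Rinv_l, Rmult_1_r by lra.
  apply Rle_trans with (1 := Hc).
  replace (2 * w) with (eta * (2 * w * / eta)) by (field; lra).
  apply Rmult_le_compat_l; lra.
Qed.

(** The side [y = eps] contributes [O(eps)], the right side nothing in the limit
    and the left side, where the function tends to [1], the value [- PI]. *)
Lemma RInt_Im_strip_fun_PI (w eta : R) : 0 < w -> 0 < eta ->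
  exists B, 0 < B /\ forall a b, a <= - B -> B <= b ->
    Rabs (RInt (fun u => Im (strip_fun w u PI)) a b + PI) <= eta.
Proof.
  intros Hw He. pose proof PI_RGT_0 as Hpi.
  assert (He' : 0 < eta / (2 * PI)) by (apply Rdiv_lt_0_compat; lra).
  destruct (strip_fun_right w _ Hw He') as [B1 [HB1 H1]].
  destruct (strip_fun_left w _ Hw He') as [B2 [HB2 H2]].
  exists (B1 + B2); split; [lra|]. intros a b Ha Hb.
  set (K := (fun y => RInt (fun u => Im (strip_fun w u y)) a b) : R -> R).
  (* [K] has to be differentiable at [PI] itself, so the denominator is kept away
     from zero slightly above the strip, for [u < b + 1] and [y < PI + d]. *)
  set (d := PI / (w * exp (b + 1))).
  pose proof (exp_pos (b + 1)) as Hexp.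
  assert (Hd : 0 < d) by (apply Rdiv_lt_0_compat; nra).
  assert (Hne : forall u v, a - 1 < u < b + 1 -> 0 < v < PI + Rmin d PI ->
            strip_den w u v <> RtoC 0).
  { intros u v Hu Hv. pose proof (Rmin_l d PI); pose proof (Rmin_r d PI).
    destruct (Rle_lt_dec v PI) as [Hv' | Hv'].
    - apply strip_den_neq_0_strip; lra.
    - apply strip_den_neq_0.
      assert (Hs : sin v = - sin (v - PI)).
      { rewrite sin_minus, cos_PI, sin_PI. ring. }
      assert (sin (v - PI) < v - PI) by (apply sin_lt_x; lra).
      assert (0 <= sin (v - PI)) by (apply sin_ge_0; lra).
      assert (exp u < exp (b + 1)) by (apply exp_increasing; lra).
      pose proof (exp_pos u).
      assert (w * exp u * sin (v - PI) <= w * exp (b + 1) * d).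
      { apply Rmult_le_compat; try nra. }
      replace (w * exp (b + 1) * d) with PI in * by (unfold d; field; lra).
      rewrite Hs. lra. }
  assert (HK : forall y, 0 < y < PI + Rmin d PI ->
            is_derive K y (Re (strip_fun w b y) - Re (strip_fun w a y))).
  { intros y Hy.
    apply (is_derive_RInt_Im_analytic (strip_fun w) (strip_fun' w)
             (a - 1) a b (b + 1) 0 (PI + Rmin d PI)); try lra.
    intros u v Hu Hv. specialize (Hne u v Hu Hv). split; [|split].
    - now apply c_derive_strip_fun_u.
    - now apply c_derive_strip_fun_y.
    - now apply c_continuous_2d_strip_fun'. }
  assert (Hdd : 0 < Rmin d PI) by now apply Rmin_pos.
  set (A := Rabs a + Rabs b).
  apply le_epsilon. intros e Hepos.
  (* The lower side sits at height [y0], chosen so that [y0 + |K y0| <= e]. *)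
  set (L := 1 + (b - a) * (w * exp A)).
  pose proof (exp_pos A) as HexpA.
  assert (HL : 0 < L).
  { unfold L. assert (0 <= (b - a) * (w * exp A)); [|lra].
    apply Rmult_le_pos; [lra | nra]. }
  set (y0 := Rmin (PI / 2) (e / L)).
  assert (Hy0 : 0 < y0 <= PI / 2).
  { split; [apply Rmin_pos; [lra | now apply Rdiv_lt_0_compat] | apply Rmin_l]. }
  assert (Hy0' : y0 * L <= e).
  { apply Rle_trans with (e / L * L); [|right; field; lra].
    apply Rmult_le_compat_r; [lra | apply Rmin_r]. }
  assert (HK1 : forall y, y0 <= y <= PI -> is_derive (fun s => K s + s) y
                  (Re (strip_fun w b y) - Re (strip_fun w a y) + 1)).
  { intros y Hy.
    refine (is_derive_plus (V := R_NormedModule) K (fun s => s) y _ _ _ _).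
    - apply HK; lra.
    - apply (is_derive_id (K := R_AbsRing)). }
  destruct (MVT_gen (fun y => K y + y) y0 PI
             (fun y => Re (strip_fun w b y) - Re (strip_fun w a y) + 1)) as [c [Hc E]].
  { rewrite Rmin_left, Rmax_right by lra. intros y Hy. apply HK1; lra. }
  { rewrite Rmin_left, Rmax_right by lra. intros y Hy.
    apply continuity_pt_filterlim.
    apply (ex_derive_continuous (V := R_NormedModule) (fun s => K s + s)).
    eexists. now apply HK1. }
  rewrite Rmin_left, Rmax_right in Hc by lra. cbv beta in E.
  specialize (H1 b c ltac:(lra) ltac:(lra)).
  specialize (H2 a c ltac:(lra) ltac:(lra)).
  assert (Hsmall : Rabs (K y0) <= (b - a) * (w * exp A * y0)).
  { apply (abs_RInt_le_const (fun u => Im (strip_fun w u y0))); [lra | |].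
    - apply (ex_RInt_continuous (V := R_CompleteNormedModule)).
      rewrite Rmin_left, Rmax_right by lra. intros u Hu.
      apply (ex_derive_continuous (V := R_NormedModule)).
      exists (Im (strip_fun' w u y0)). apply c_derive_strip_fun_u, Hne; lra.
    - intros u Hu. apply Im_strip_fun_small; trivial.
      apply Rabs_le_between. unfold A.
      pose proof (Rle_abs b); pose proof (Rle_abs (- a)). rewrite Rabs_Ropp in *.
      pose proof (Rabs_pos a); pose proof (Rabs_pos b). lra. }
  change (Rabs (K PI + PI) <= eta + e).
  assert (Hfac : Rabs ((Re (strip_fun w b c) - Re (strip_fun w a c) + 1) * (PI - y0)) <= eta).
  { rewrite Rabs_mult, (Rabs_pos_eq (PI - y0)) by lra.
    apply Rle_trans with (eta / PI * PI); [|right; field; lra].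
    apply Rmult_le_compat; try lra; [apply Rabs_pos|].
    replace (Re (strip_fun w b c) - Re (strip_fun w a c) + 1)
      with (Re (strip_fun w b c) + - (Re (strip_fun w a c) - 1)) by ring.
    eapply Rle_trans; [apply Rabs_triang|]. rewrite Rabs_Ropp.
    replace (eta / PI) with (eta / (2 * PI) + eta / (2 * PI)) by (field; lra). lra. }
  replace (K PI + PI) with ((K PI + PI - (K y0 + y0)) + (K y0 + y0)) by ring.
  rewrite E.
  eapply Rle_trans; [apply Rabs_triang|].
  assert (Rabs (K y0 + y0) <= e); [|lra].
  eapply Rle_trans; [apply Rabs_triang|]. rewrite (Rabs_pos_eq y0) by lra.
  unfold L in Hy0'. lra.
Qed.

(** One sequence of integrals over growing symmetric intervals stands for the
    two-sided improper integral: linearity and comparison are then those of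
    [is_lim_seq]. *)
Definition sym_integral (f : R -> R) (l : R) : Prop :=
  is_lim_seq (fun N => RInt f (- INR N) (INR N)) l.

Lemma is_lim_seq_eps (u : nat -> R) (l : R) :
  (forall eps, 0 < eps -> exists N : R, forall n, N <= INR n -> Rabs (u n - l) <= eps) ->
  is_lim_seq u l.
Proof.
  intros H. apply is_lim_seq_spec. intros eps. simpl.
  destruct (H (eps / 2)) as [N HN].
  { pose proof (cond_pos eps); lra. }
  destruct (nfloor_ex (Rmax N 0)) as [m Hm]; [apply Rmax_r|].
  exists (S m). intros n Hn. apply le_INR in Hn. rewrite S_INR in Hn.
  apply Rle_lt_trans with (eps / 2).
  - apply HN. pose proof (Rmax_l N 0); lra.
  - pose proof (cond_pos eps); lra.
Qed.

Lemma atan_tail (x : R) : 0 < x -> 0 <= PI / 2 - atan x <= / x.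
Proof.
  intros Hx. rewrite <- atan_inv by exact Hx.
  assert (Hi : 0 < / x) by now apply Rinv_0_lt_compat.
  split.
  - rewrite <- atan_0. left; now apply atan_increasing.
  - destruct (MVT_segment (fun s => atan (s * / x)) (fun s => / x * / (1 + (s * / x) ^ 2)))
      as [c [Hc E]].
    { intros s; auto_derive; trivial.
      unfold Rsqr. field. repeat split; try lra; try (apply Rgt_not_eq; nra). }
    rewrite Rmult_1_l, Rmult_0_l, atan_0, Rminus_0_r in E. rewrite E.
    rewrite <- (Rmult_1_r (/ x)) at 3. apply Rmult_le_compat_l; [lra|].
    rewrite <- Rinv_1. apply Rinv_le_contravar; [lra|].
    pose proof (pow2_ge_0 (c * / x)); lra.
Qed.

Lemma exp_ge_identity_plus (x : R) : 0 <= x -> 1 + x ^ 2 / 2 <= exp x - x.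
Proof. intros Hx; pose proof (exp_ge_quadratic x Hx); lra. Qed.

(** On the upper side the numerator [w (1 + e^u)] is [P' + 1 + w], so that the
    integrand is the wanted kernel plus the derivative of an arctangent. *)
Lemma Im_strip_fun_PI (w u : R) :
  let P := w * (exp u + 1) - u in
  Im (strip_fun w u PI) =
    - (PI * (1 + w) * / (P ^ 2 + PI ^ 2) + PI * (w * exp u - 1) * / (P ^ 2 + PI ^ 2)).
Proof.
  intros P. pose proof PI_RGT_0 as Hpi.
  assert (Hn : P ^ 2 + PI ^ 2 <> 0) by (apply Rgt_not_eq; nra).
  change (Im (strip_fun w u PI)) with
    (u * (- Im (strip_den w u PI) / (Re (strip_den w u PI) ^ 2 + Im (strip_den w u PI) ^ 2)) +
     PI * (Re (strip_den w u PI) / (Re (strip_den w u PI) ^ 2 + Im (strip_den w u PI) ^ 2))).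
  assert (Er : Re (strip_den w u PI) = - P).
  { unfold strip_den, cexp, Re, P; simpl. rewrite cos_PI. ring. }
  assert (Ei : Im (strip_den w u PI) = PI).
  { unfold strip_den, cexp, Im; simpl. rewrite sin_PI. ring. }
  rewrite Er, Ei. replace ((- P) ^ 2) with (P ^ 2) by ring.
  unfold P in *. field. exact Hn.
Qed.

(** The residue theorem in the strip, with the pole at the real zero [ln w] of
    [z + e^z - (w + ln w)]. *)
Theorem sym_integral_Lambert_kernel (w : R) : 0 < w ->
  sym_integral (fun x => / ((exp x - x + (w + ln w)) ^ 2 + PI ^ 2)) (/ (1 + w)).
Proof.
  intros Hw. pose proof PI_RGT_0 as Hpi. set (t := w + ln w). set (lam := ln w) in *.
  set (P := fun u => w * (exp u + 1) - u).
  set (g := fun u => / (P u ^ 2 + PI ^ 2)).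
  assert (Hpos : forall u, P u ^ 2 + PI ^ 2 <> 0) by (intros; apply Rgt_not_eq; nra).
  assert (Eshift : forall u, P (u + - lam) = exp u - u + t).
  { intros u. unfold P, t, lam. rewrite exp_plus, exp_Ropp, exp_ln by exact Hw.
    field. lra. }
  assert (Hg : forall u, continuous g u).
  { intros u. apply (ex_derive_continuous (V := R_NormedModule)).
    unfold g, P. auto_derive. repeat split; trivial; apply Hpos. }
  assert (Hh : forall u, continuous (fun u => PI * (w * exp u - 1) * g u) u).
  { intros u. apply (ex_derive_continuous (V := R_NormedModule)).
    unfold g, P. auto_derive. repeat split; trivial; apply Hpos. }
  assert (Hi : forall a b, RInt (fun u => Im (strip_fun w u PI)) a b =
             - (PI * (1 + w) * RInt g a b + (atan (P b / PI) - atan (P a / PI)))).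
  { intros a b. apply is_RInt_unique.
    apply is_RInt_ext with
      (fun u => opp (plus (scal (PI * (1 + w)) (g u)) (PI * (w * exp u - 1) * g u))).
    { intros u _. rewrite Im_strip_fun_PI. reflexivity. }
    apply (is_RInt_opp (V := R_NormedModule)).
    apply (is_RInt_plus (V := R_NormedModule)).
    - apply (is_RInt_scal (V := R_NormedModule)).
      apply (RInt_correct (V := R_CompleteNormedModule)).
      apply (ex_RInt_continuous (V := R_CompleteNormedModule)). intros; apply Hg.
    - apply (is_RInt_derive (fun u => atan (P u / PI))).
      + intros u _. unfold g, P. auto_derive; trivial.
        unfold Rsqr. field. specialize (Hpos u). unfold P in Hpos.
        repeat split; try lra; try (apply Rgt_not_eq; nra).
      + intros u _. apply Hh. }
  assert (Hint : forall N : nat, RInt (fun x => / ((exp x - x + t) ^ 2 + PI ^ 2)) (- INR N) (INR N)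
            = RInt g (- INR N + - lam) (INR N + - lam)).
  { intros N.
    transitivity (RInt g (1 * - INR N + - lam) (1 * INR N + - lam)); [|now rewrite !Rmult_1_l].
    rewrite <- (RInt_comp_lin (V := R_CompleteNormedModule)).
    - apply RInt_ext. intros x _. unfold g, scal, mult; simpl.
      now rewrite !Rmult_1_l, Eshift.
    - apply (ex_RInt_continuous (V := R_CompleteNormedModule)). intros; apply Hg. }
  unfold sym_integral. apply is_lim_seq_eps. intros eps Heps.
  set (c := PI * (1 + w)).
  assert (Hc : 0 < c) by (unfold c; nra).
  assert (He : 0 < c * eps / 2) by (assert (0 < c * eps) by nra; lra).
  destruct (RInt_Im_strip_fun_PI w _ Hw He) as [B [HB HR]].
  assert (HPI : 0 < PI / (c * eps / 2)) by now apply Rdiv_lt_0_compat.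
  exists (B + Rabs lam + 2 + Rabs t + PI / (c * eps / 2)).
  intros N HN. rewrite Hint.
  pose proof (Rabs_pos lam); pose proof (Rabs_pos t).
  pose proof (Rle_abs lam); pose proof (Rle_abs (- lam)); rewrite Rabs_Ropp in *.
  pose proof (Rle_abs (- t)); rewrite Rabs_Ropp in *.
  specialize (HR (- INR N + - lam) (INR N + - lam) ltac:(lra) ltac:(lra)).
  rewrite Hi, !Eshift in HR.
  set (X := RInt g _ _) in *.
  assert (HX1 : PI / (c * eps / 2) <= exp (INR N) - INR N + t).
  { pose proof (exp_ge_identity_plus (INR N) (pos_INR N)). nra. }
  assert (HX2 : PI / (c * eps / 2) <= exp (- INR N) - - INR N + t).
  { pose proof (exp_pos (- INR N)). lra. }
  assert (Hat : forall Y, PI / (c * eps / 2) <= Y ->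
            0 <= PI / 2 - atan (Y / PI) <= c * eps / 2).
  { intros Y HY. assert (HY' : 0 < Y / PI) by (apply Rdiv_lt_0_compat; lra).
    destruct (atan_tail _ HY') as [K1 K2]. split; [exact K1|].
    apply Rle_trans with (1 := K2).
    rewrite <- (Rinv_inv (c * eps / 2)). apply Rinv_le_contravar.
    - now apply Rinv_0_lt_compat.
    - apply Rmult_le_reg_r with PI; [lra|].
      replace (Y / PI * PI) with Y by (field; lra).
      unfold Rdiv at 1 in HY. rewrite Rmult_comm. exact HY. }
  pose proof (Hat _ HX1) as A1. pose proof (Hat _ HX2) as A2.
  fold c in HR.
  apply Rabs_le_between in HR. apply Rabs_le_between.
  replace (X - / (1 + w)) with ((c * X - PI) / c) by (unfold c; field; lra).
  split; apply Rmult_le_reg_r with c; try exact Hc;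
    replace ((c * X - PI) / c * c) with (c * X - PI) by (field; lra); lra.
Qed.

(** * Improper integrals over the line *)

Lemma sym_integral_ext (f g : R -> R) (l : R) :
  (forall x, f x = g x) -> sym_integral f l -> sym_integral g l.
Proof.
  intros E. apply is_lim_seq_ext. intros n. apply RInt_ext. intros; apply E.
Qed.

Lemma sym_integral_unique (f : R -> R) (l m : R) :
  sym_integral f l -> sym_integral f m -> l = m.
Proof.
  intros H K. apply is_lim_seq_unique in H. apply is_lim_seq_unique in K.
  rewrite H in K. now injection K.
Qed.

Lemma ex_RInt_everywhere (f : R -> R) (a b : R) :
  (forall x, continuous f x) -> ex_RInt f a b.
Proof. intros H; apply (ex_RInt_continuous (V := R_CompleteNormedModule)); auto. Qed.

Lemma sym_integral_lin (f g : R -> R) (c d l m : R) :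
  (forall x, continuous f x) -> (forall x, continuous g x) ->
  sym_integral f l -> sym_integral g m ->
  sym_integral (fun x => c * f x + d * g x) (c * l + d * m).
Proof.
  intros Hf Hg Hl Hm. unfold sym_integral.
  apply is_lim_seq_ext with
    (fun N => c * RInt f (- INR N) (INR N) + d * RInt g (- INR N) (INR N)).
  - intros N. symmetry. apply is_RInt_unique.
    apply (is_RInt_plus (V := R_NormedModule));
      apply (is_RInt_scal (V := R_NormedModule));
      apply (RInt_correct (V := R_CompleteNormedModule)); now apply ex_RInt_everywhere.
  - apply is_lim_seq_plus'; now apply (is_lim_seq_scal_l _ _ (Finite _)).
Qed.

Lemma sym_integral_abs_le (f : R -> R) (l B : R) :
  sym_integral f l -> (forall N, Rabs (RInt f (- INR N) (INR N)) <= B) -> Rabs l <= B.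
Proof.
  intros Hl HB. apply Rabs_le_between.
  assert (H : forall N, - B <= RInt f (- INR N) (INR N) <= B).
  { intros N; apply Rabs_le_between, HB. }
  split.
  - apply (is_lim_seq_le (fun _ => - B) _ (- B) l (fun n => proj1 (H n)));
      [apply is_lim_seq_const | exact Hl].
  - apply (is_lim_seq_le _ (fun _ => B) l B (fun n => proj2 (H n)));
      [exact Hl | apply is_lim_seq_const].
Qed.

Lemma is_RInt_inv_1_sqr (K a b : R) :
  is_RInt (fun x => K / (1 + x ^ 2)) a b (K * atan b - K * atan a).
Proof.
  apply (is_RInt_derive (fun x => K * atan x)).
  - intros x _. auto_derive; trivial. unfold Rsqr. field. apply Rgt_not_eq; nra.
  - intros x _. apply (ex_derive_continuous (V := R_NormedModule)).
    auto_derive. apply Rgt_not_eq; nra.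
Qed.

Lemma RInt_dominated_le (f : R -> R) (K a b : R) : a <= b ->
  (forall x, continuous f x) -> (forall x, Rabs (f x) <= K / (1 + x ^ 2)) ->
  Rabs (RInt f a b) <= K * PI.
Proof.
  intros Hab Hc Hf.
  assert (HK : 0 <= K).
  { specialize (Hf 0). pose proof (Rabs_pos (f 0)).
    replace (K / (1 + 0 ^ 2)) with K in Hf by field. lra. }
  apply Rle_trans with (RInt (fun x => K / (1 + x ^ 2)) a b).
  - eapply Rle_trans; [apply abs_RInt_le; [exact Hab | now apply ex_RInt_everywhere]|].
    apply RInt_le; trivial.
    + apply ex_RInt_everywhere. intros x. apply continuous_comp; [apply Hc|].
      apply continuous_Rabs.
    + eexists. apply is_RInt_inv_1_sqr.
  - rewrite (is_RInt_unique _ _ _ _ (is_RInt_inv_1_sqr K a b)).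
    pose proof (atan_bound a); pose proof (atan_bound b).
    replace (K * atan b - K * atan a) with (K * (atan b - atan a)) by ring.
    apply Rmult_le_compat_l; lra.
Qed.

Lemma sym_integral_nonneg_ex (f : R -> R) (K : R) :
  (forall x, continuous f x) -> (forall x, 0 <= f x <= K / (1 + x ^ 2)) ->
  exists l, sym_integral f l.
Proof.
  intros Hc Hf.
  destruct (ex_finite_lim_seq_incr (fun N => RInt f (- INR N) (INR N)) (K * PI)) as [l Hl].
  - intros N. rewrite S_INR. pose proof (pos_INR N).
    pose proof (RInt_Chasles f (- (INR N + 1)) (- INR N) (INR N + 1)) as E1.
    pose proof (RInt_Chasles f (- INR N) (INR N) (INR N + 1)) as E2.
    rewrite <- E1, <- E2 by now apply ex_RInt_everywhere. unfold plus; simpl.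
    assert (forall a b, a <= b -> 0 <= RInt f a b).
    { intros a b Hab. apply RInt_ge_0; [exact Hab | now apply ex_RInt_everywhere |].
      intros x _; apply Hf. }
    assert (0 <= RInt f (- (INR N + 1)) (- INR N)) by (apply H0; lra).
    assert (0 <= RInt f (INR N) (INR N + 1)) by (apply H0; lra). lra.
  - intros N. apply Rle_trans with (1 := Rle_abs _).
    apply RInt_dominated_le; trivial.
    + pose proof (pos_INR N); lra.
    + intros x. rewrite Rabs_pos_eq; apply Hf.
  - now exists l.
Qed.

(** Adding the majorant makes the integrand nonnegative, hence the truncated
    integrals monotone and bounded. *)
Lemma sym_integral_dominated (f : R -> R) (K : R) :
  (forall x, continuous f x) -> (forall x, Rabs (f x) <= K / (1 + x ^ 2)) ->
  exists l, sym_integral f l.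
Proof.
  intros Hc Hf.
  set (q := fun x => K / (1 + x ^ 2)).
  assert (Hq : forall x, continuous q x).
  { intros x. apply (ex_derive_continuous (V := R_NormedModule)). unfold q.
    auto_derive. apply Rgt_not_eq; nra. }
  assert (Hfq : forall x, - q x <= f x <= q x) by (intros; apply Rabs_le_between, Hf).
  assert (Hpos : forall x, continuous (fun x => f x + q x) x).
  { intros x. now apply (continuous_plus (V := R_NormedModule) f q). }
  destruct (sym_integral_nonneg_ex q K Hq) as [l Hl].
  { intros x. specialize (Hfq x). split; [lra | apply Rle_refl]. }
  destruct (sym_integral_nonneg_ex (fun x => f x + q x) (2 * K) Hpos) as [m Hm].
  { intros x. specialize (Hfq x).
    replace (2 * K / (1 + x ^ 2)) with (2 * q x); [lra|].
    unfold q. field. apply Rgt_not_eq; nra. }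
  exists (1 * m + -1 * l).
  apply sym_integral_ext with (fun x => 1 * (f x + q x) + -1 * q x); [intros; ring|].
  now apply (sym_integral_lin (fun x => f x + q x)).
Qed.

(** * Coefficients as integrals *)

(** For real [x], [z + e^z] takes at [z = x + i PI] the value [- kernel x]. *)
Definition kernel (u : R) : C := (exp u - u, - PI).

(** Quadratic growth on the whole line: near [0] it gives the Gaussian-like
    decay of the powers, at infinity their integrability. *)
Lemma kernel_re_sqr (u : R) : 1 + u ^ 2 / 2 <= (exp u - u) ^ 2.
Proof.
  destruct (Rle_lt_dec 0 u) as [Hu | Hu].
  - pose proof (exp_ge_identity_plus u Hu). nra.
  - destruct (MVT_segment (fun s => (exp (s * u) - s * u) ^ 2 - (s * u) ^ 2 / 2)
      (fun s => u * (2 * (exp (s * u) - s * u) * (exp (s * u) - 1) - s * u)))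
      as [c [Hc E]].
    { intros s; auto_derive; trivial. field. }
    rewrite !Rmult_1_l, !Rmult_0_l, exp_0 in E.
    set (y := c * u) in *. assert (Hy : y <= 0) by (unfold y; nra).
    set (e := exp y) in *.
    assert (He : 0 < e) by apply exp_pos.
    assert (He1 : 1 + y <= e) by (unfold e; apply exp_ineq1_le).
    assert (He2 : e * (1 - y) <= 1).
    { pose proof (exp_ineq1_le (- y)) as H. rewrite exp_Ropp in H. fold e in H.
      apply Rmult_le_reg_l with (/ e); [now apply Rinv_0_lt_compat|].
      rewrite <- Rmult_assoc, Rinv_l by lra. lra. }
    assert (H1 : 2 * (e - y) * (e - 1) - y <= 0).
    { assert (H2 : (2 * (e - y) * (1 - e)) * (1 - y) >= (- y) * (1 - y)); [|nra].
      assert (H3 : (1 - e) * (1 - y) >= - y) by nra.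
      assert (H4 : 2 * (e - y) >= 1 - y) by nra.
      nra. }
    nra.
Qed.

Lemma kernel_Cmod_sqr (u : R) : 1 + PI ^ 2 + u ^ 2 / 2 <= Cmod (kernel u) ^ 2.
Proof.
  rewrite Cmod2_alt. unfold kernel, Re, Im; cbn [fst snd].
  pose proof (kernel_re_sqr u). nra.
Qed.

Lemma kernel_Cmod_ge_2 (u : R) : 2 <= Cmod (kernel u).
Proof.
  pose proof (kernel_Cmod_sqr u). pose proof (Cmod_ge_0 (kernel u)).
  pose proof PI2_1. nra.
Qed.

Lemma kernel_neq_0 (u : R) : kernel u <> RtoC 0.
Proof. apply Cmod_gt_0. pose proof (kernel_Cmod_ge_2 u); lra. Qed.

Lemma c_derive_kernel (u : R) : c_derive kernel u (exp u - 1, 0).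
Proof. split; simpl; unfold Re, Im; simpl; auto_derive; trivial; ring. Qed.

Lemma c_continuous_inv (F : R -> C) :
  (forall x, exists l, c_derive F x l) -> (forall x, F x <> RtoC 0) ->
  c_continuous (fun x => / F x)%C.
Proof.
  intros H H0. apply c_derive_continuous. intros x.
  destruct (H x) as [l Hl]. eexists. apply c_derive_inv; [exact Hl | apply H0].
Qed.

Lemma c_continuous_inv_kernel_pow (n : nat) :
  c_continuous (fun u => / kernel u ^ n)%C.
Proof.
  apply c_continuous_inv.
  - intros u. eexists. apply c_derive_pow, c_derive_kernel.
  - intros u. apply Cpow_nz, kernel_neq_0.
Qed.

Lemma im_le_Cmod (z : C) : Rabs (Im z) <= Cmod z.
Proof. eapply Rle_trans; [|apply Rmax_Cmod]. apply Rmax_r. Qed.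

Lemma pow_ge_factor (r : R) (k : nat) : 1 <= r -> r <= r ^ S k.
Proof.
  intros Hr. simpl. pose proof (pow_R1_Rle r k Hr). nra.
Qed.

Lemma kernel_Cmod_sqr_inv (u : R) : / Cmod (kernel u) ^ 2 <= 2 / (1 + u ^ 2).
Proof.
  pose proof (kernel_Cmod_sqr u) as H. pose proof PI_RGT_0.
  replace (2 / (1 + u ^ 2)) with (/ ((1 + u ^ 2) / 2)) by (field; apply Rgt_not_eq; nra).
  apply Rinv_le_contravar; nra.
Qed.

(** For the exponent [1] the modulus of [1 / kernel] is not integrable, but its
    imaginary part [PI / |kernel|^2] is. *)
Lemma Im_inv_kernel_pow_le (k : nat) (u : R) :
  Rabs (Im (/ kernel u ^ S k)%C) <= (2 * PI) / (1 + u ^ 2).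
Proof.
  pose proof (kernel_Cmod_ge_2 u) as H2. pose proof PI2_1 as Hpi.
  pose proof (kernel_Cmod_sqr_inv u) as Hi.
  assert (Hd : 2 * PI / (1 + u ^ 2) = PI * (2 / (1 + u ^ 2))) by (field; apply Rgt_not_eq; nra).
  assert (H0 : 0 < / Cmod (kernel u) ^ 2) by (apply Rinv_0_lt_compat; nra).
  rewrite Hd. destruct k as [|k].
  - rewrite Cpow_1_r.
    replace (Im (/ kernel u)%C) with (PI * / Cmod (kernel u) ^ 2).
    + rewrite Rabs_pos_eq by nra. apply Rmult_le_compat_l; lra.
    + rewrite Cmod2_alt. unfold Im, Re; simpl.
      pose proof (pow2_ge_0 (exp u - u)). assert (0 < PI ^ 2) by nra.
      field. apply Rgt_not_eq; nra.
  - eapply Rle_trans; [apply im_le_Cmod|].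
    rewrite Cmod_inv, Cmod_pow by apply Cpow_nz, kernel_neq_0.
    apply Rle_trans with (/ Cmod (kernel u) ^ 2); [|nra].
    apply Rinv_le_contravar; [nra|].
    apply Rle_pow; [lra | lia].
Qed.

Definition kernel_moment (k : nat) : R :=
  real (Lim_seq (fun N => RInt (fun u => Im (/ kernel u ^ S k)%C) (- INR N) (INR N))).

Lemma sym_integral_kernel_moment (k : nat) :
  sym_integral (fun u => Im (/ kernel u ^ S k)%C) (kernel_moment k).
Proof.
  destruct (sym_integral_dominated (fun u => Im (/ kernel u ^ S k)%C) (2 * PI)) as [l Hl].
  - apply c_continuous_inv_kernel_pow.
  - intros; apply Im_inv_kernel_pow_le.
  - unfold kernel_moment. unfold sym_integral in Hl.
    now rewrite (is_lim_seq_unique _ _ Hl).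
Qed.

(** The remainder of the geometric expansion of [1 / (kernel + t)] after [m]
    terms, without its factor [(-t)^m]. *)
Definition geom_rem (t : R) (m : nat) (u : R) : C :=
  (/ (kernel u ^ m * (kernel u + t)))%C.

Lemma kernel_shift_Cmod (t u : R) : Rabs t < 1 ->
  Cmod (kernel u) / 2 <= Cmod (kernel u + t).
Proof.
  intros Ht.
  pose proof (Cmod_triangle_lower (kernel u) t) as H. rewrite Cmod_R in H.
  pose proof (kernel_Cmod_ge_2 u). lra.
Qed.

Lemma kernel_shift_neq_0 (t u : R) : Rabs t < 1 -> (kernel u + t)%C <> RtoC 0.
Proof.
  intros Ht.
  apply Cmod_gt_0. pose proof (kernel_shift_Cmod t u Ht). pose proof (kernel_Cmod_ge_2 u). lra.
Qed.

Lemma c_continuous_geom_rem (t : R) (m : nat) : Rabs t < 1 ->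
  c_continuous (geom_rem t m).
Proof.
  intros Ht.
  apply c_continuous_inv.
  - intros u. eexists. apply c_derive_mult; [apply c_derive_pow, c_derive_kernel|].
    apply c_derive_plus; [apply c_derive_kernel | apply c_derive_const].
  - intros u. apply Cmult_neq_0; [apply Cpow_nz, kernel_neq_0 | now apply kernel_shift_neq_0].
Qed.

Lemma geom_rem_le (t : R) (m : nat) (u : R) : Rabs t < 1 ->
  Rabs (Im (geom_rem t (S m) u)) <= 4 / (1 + u ^ 2).
Proof.
  intros Ht.
  eapply Rle_trans; [apply im_le_Cmod|].
  unfold geom_rem. rewrite Cmod_inv, Cmod_mult, Cmod_pow
    by (apply Cmult_neq_0; [apply Cpow_nz, kernel_neq_0 | now apply kernel_shift_neq_0]).
  pose proof (kernel_Cmod_ge_2 u) as H2.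
  pose proof (kernel_shift_Cmod t u Ht) as H3.
  pose proof (pow_ge_factor (Cmod (kernel u)) m ltac:(lra)) as H4.
  apply Rle_trans with (/ (Cmod (kernel u) ^ 2 / 2)).
  - apply Rinv_le_contravar; nra.
  - replace (/ (Cmod (kernel u) ^ 2 / 2)) with (2 * / Cmod (kernel u) ^ 2)
      by (field; nra).
    replace (4 / (1 + u ^ 2)) with (2 * (2 / (1 + u ^ 2))) by (field; apply Rgt_not_eq; nra).
    apply Rmult_le_compat_l; [lra | apply kernel_Cmod_sqr_inv].
Qed.

(** One step of the geometric expansion
    [1 / (kernel + t) = 1 / kernel - t / (kernel (kernel + t))]. *)
Lemma geom_rem_S (t : R) (m : nat) (u : R) : Rabs t < 1 ->
  Im (geom_rem t m u) = 1 * Im (/ kernel u ^ S m)%C + (- t) * Im (geom_rem t (S m) u).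
Proof.
  intros Ht.
  assert (E : geom_rem t m u = (/ kernel u ^ S m + RtoC (- t) * geom_rem t (S m) u)%C).
  { unfold geom_rem. rewrite RtoC_opp, Cpow_S. 
    pose proof (kernel_neq_0 u). pose proof (kernel_shift_neq_0 t u Ht).
    pose proof (Cpow_nz (kernel u) m H). field. repeat split; trivial. }
  rewrite E. unfold Im; simpl. ring.
Qed.

Lemma sym_integral_geom_rem (w t : R) (m : nat) :
  0 < w -> w + ln w = t -> Rabs t < 1 ->
  exists l, sym_integral (fun u => Im (geom_rem t m u)) l /\
    PI / (1 + w) = sum_f_R0 (fun k => (- t) ^ k * kernel_moment k) m
                   - (- t) ^ m * kernel_moment m + (- t) ^ m * l.
Proof.
  intros Hw Hwt Ht.
  induction m as [|m [l [Hl E]]].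
  - exists (PI / (1 + w)). split; [|simpl; ring].
    pose proof (sym_integral_Lambert_kernel w Hw) as H. rewrite Hwt in H.
    replace (PI / (1 + w)) with (PI * / (1 + w) + 0 * / (1 + w)) by (unfold Rdiv; ring).
    assert (Hc : forall u, continuous (fun x => / ((exp x - x + t) ^ 2 + PI ^ 2)) u).
    { intros u. apply (ex_derive_continuous (V := R_NormedModule)). auto_derive.
      pose proof PI_RGT_0. pose proof (pow2_ge_0 (exp u - u + t)).
      apply Rgt_not_eq; nra. }
    apply sym_integral_ext with (2 := sym_integral_lin _ _ _ _ _ _ Hc Hc H H).
    intros u. unfold geom_rem.
    replace (kernel u ^ 0 * (kernel u + t))%C with ((exp u - u + t, - PI) : C).
    + unfold Im; simpl. pose proof PI_RGT_0.
      pose proof (pow2_ge_0 (exp u - u + t)). assert (0 < PI ^ 2) by nra.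
      field. apply Rgt_not_eq; nra.
    + unfold kernel, RtoC, Cplus, Cmult; simpl. f_equal; ring.
  - destruct (sym_integral_dominated (fun u => Im (geom_rem t (S m) u)) 4) as [l' Hl'].
    { now apply c_continuous_geom_rem. }
    { intros; now apply geom_rem_le. }
    exists l'. split; [exact Hl'|].
    assert (El : l = 1 * kernel_moment m + (- t) * l').
    { apply sym_integral_unique with (1 := Hl).
      apply sym_integral_ext with (1 := fun u => eq_sym (geom_rem_S t m u Ht)).
      apply (sym_integral_lin (fun u => Im (/ kernel u ^ S m)%C)).
      - apply c_continuous_inv_kernel_pow.
      - now apply c_continuous_geom_rem.
      - apply sym_integral_kernel_moment.
      - exact Hl'. }
    rewrite E, El, tech5. simpl. ring.
Qed.

(** The geometric expansion of [1 / (kernel + t)] in powers of [- t], integrated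
    term by term; the remainder after [m] terms is [O(|t|^m)] uniformly against the
    integrable majorant [1 / (1 + u^2)]. *)
Theorem is_series_kernel_moment (w t : R) :
  0 < w -> w + ln w = t -> Rabs t < 1 ->
  is_series (fun k => (- t) ^ k * kernel_moment k) (PI / (1 + w)).
Proof.
  intros Hw Hwt Ht.
  assert (Hb : forall m, Rabs (sum_f_R0 (fun k => (- t) ^ k * kernel_moment k) m - PI / (1 + w))
             <= 4 * PI * Rabs t ^ S m).
  { intros m. destruct (sym_integral_geom_rem w t (S m) Hw Hwt Ht) as [l [Hl E]].
    rewrite E, tech5.
    match goal with |- Rabs ?x <= _ => replace x with (- ((- t) ^ S m * l)) by ring end.
    rewrite Rabs_Ropp, Rabs_mult, <- RPow_abs, Rabs_Ropp.
    assert (HL : Rabs l <= 4 * PI).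
    { apply (sym_integral_abs_le _ _ _ Hl). intros N.
      apply RInt_dominated_le.
      - pose proof (pos_INR N); lra.
      - now apply c_continuous_geom_rem.
      - intros; now apply geom_rem_le. }
    rewrite (Rmult_comm (4 * PI)). apply Rmult_le_compat_l; [|exact HL].
    apply pow_le, Rabs_pos. }
  assert (H : is_lim_seq (fun m => sum_f_R0 (fun k => (- t) ^ k * kernel_moment k) m)
                (PI / (1 + w))).
  { apply is_lim_seq_ext with (fun m => (sum_f_R0 (fun k => (- t) ^ k * kernel_moment k) m
        - PI / (1 + w)) + PI / (1 + w)); [intros; ring|].
    replace (Finite (PI / (1 + w))) with (Finite (0 + PI / (1 + w))) by (f_equal; ring).
    apply is_lim_seq_plus'; [|apply is_lim_seq_const].
    apply is_lim_seq_abs_0.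
    apply is_lim_seq_le_le with (fun _ => 0) (fun m => 4 * PI * Rabs t ^ S m).
    - intros m. split; [apply Rabs_pos | apply Hb].
    - apply is_lim_seq_const.
    - replace (Finite 0) with (Rbar_mult (4 * PI) 0) by (simpl; f_equal; ring).
      apply is_lim_seq_scal_l.
      apply (is_lim_seq_incr_1 (fun m => Rabs t ^ m)).
      apply is_lim_seq_geom. now rewrite Rabs_Rabsolu. }
  apply is_lim_seq_ext with (2 := H). intros n. now rewrite sum_n_Reals.
Qed.

(** Taking logarithms turns the equation into [v + ln v = t], whose left side
    increases. *)
Lemma mul_exp_unique (v w t : R) :
  v * exp v = exp t -> 0 < w -> w + ln w = t -> v = w.
Proof.
  intros Hv Hw Hwt.
  pose proof (exp_pos t). pose proof (exp_pos v).
  assert (Hv0 : 0 < v) by nra.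
  assert (Hvt : v + ln v = t).
  { rewrite <- (ln_exp t), <- Hv, ln_mult, ln_exp by trivial. ring. }
  destruct (Rtotal_order v w) as [Hl | [He | Hg]]; trivial; exfalso.
  - pose proof (ln_increasing v w Hv0 Hl). lra.
  - pose proof (ln_increasing w v Hw Hg). lra.
Qed.

Lemma LambertW_exp_spec (t : R) :
  0 < LambertW (exp t) /\ LambertW (exp t) + ln (LambertW (exp t)) = t.
Proof.
  pose proof (exp_pos t) as Ht.
  destruct (IVT_gen (fun x => x * exp x) 0 (exp t) (exp t)) as [w [_ Ew]].
  - intros x. apply continuity_pt_filterlim.
    apply (ex_derive_continuous (V := R_NormedModule) (fun x => x * exp x)).
    auto_derive; trivial.
  - assert (1 <= exp (exp t)) by (pose proof (exp_ineq1_le (exp t)); lra).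
    rewrite Rmult_0_l. unfold Rmin, Rmax. destruct (Rle_dec 0 _); nra.
  - pose proof (exp_pos w) as Hew.
    assert (Hw : 0 < w) by nra.
    assert (Hwt : w + ln w = t).
    { rewrite <- (ln_exp t), <- Ew, ln_mult, ln_exp by trivial. ring. }
    assert (E : LambertW (exp t) = w).
    { unfold LambertW. apply (iota_unique (V := R_CompleteNormedModule)).
      - intros y [_ Hy]. now apply mul_exp_unique with t.
      - split; [lra | exact Ew]. }
    rewrite E. now split.
Qed.

(** Terms of a series that converges at [x] tend to [0], which they do not
    outside the disk of convergence. *)
Lemma CV_radius_pos (a : nat -> R) (x l : R) :
  0 < x -> is_pseries a x l -> Rbar_lt 0 (CV_radius a).
Proof.
  intros Hx H.
  apply Rbar_lt_le_trans with x; [exact Hx|].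
  apply Rbar_not_lt_le. intros Hlt.
  apply (CV_disk_outside a x); [rewrite Rabs_pos_eq by lra; exact Hlt|].
  apply (ex_series_lim_0 (fun n => a n * x ^ n)). exists l.
  exact (proj1 (is_pseries_R a x l) H).
Qed.

Lemma ball_0_Rabs (r t : R) : ball 0 r t -> Rabs t < r.
Proof.
  intros H. replace t with (t - 0) by ring. exact H.
Qed.

Lemma ball_0 (r t : R) : Rabs t < r -> ball 0 r t.
Proof.
  intros H. replace t with (t - 0) in H by ring. exact H.
Qed.

(** Differentiating [f + ln f = t] gives [f' = 1 - 1 / (1 + f)], whose expansion
    is the one of the moments. *)
Theorem Lambert_coeff (a : nat -> R) (n : nat) :
  is_W_exp_expansion a -> (2 <= n)%nat ->
  INR n * a n = (-1) ^ n * kernel_moment (pred n) / PI.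
Proof.
  intros [r Hr] Hn. pose proof PI_RGT_0 as Hpi.
  set (f := fun t => LambertW (exp t)).
  set (b := fun k => match k with O => omega0 | S _ => a k end).
  set (d := fun k => (match k with O => 1 | S _ => 0 end) - (-1) ^ k * kernel_moment k / PI).
  assert (Hb : forall t, Rabs t < r -> is_pseries b t (f t)).
  { intros t Ht. apply is_pseries_R.
    apply is_series_decr_1.
    refine (eq_rect _ (fun l => is_series (fun k => a (S k) * t ^ S k) l)
              (Hr t (ball_0 _ _ Ht)) _ _).
    unfold plus, opp, f, b; simpl. ring. }
  assert (Hd : forall t, Rabs t < 1 -> is_pseries d t (1 - / (1 + f t))).
  { intros t Ht. apply is_pseries_R.
    destruct (LambertW_exp_spec t) as [H1 H2].
    pose proof (is_series_kernel_moment _ _ H1 H2 Ht) as Hs.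
    apply (is_series_scal_r (- / PI)) in Hs.
    assert (H0 : is_series (fun k => match k with O => 1 | S _ => 0 end) 1).
    { apply is_series_decr_1. unfold plus, opp; simpl.
      replace (1 + - (1)) with 0 by ring.
      change (is_lim_seq (sum_n (fun _ => 0)) 0).
      apply is_lim_seq_ext with (fun _ => 0); [|apply is_lim_seq_const].
      intros n'. rewrite sum_n_const. ring. }
    pose proof (is_series_plus _ _ _ _ H0 Hs) as Hsum.
    replace (1 - / (1 + f t)) with (plus 1 (PI / (1 + LambertW (exp t)) * - / PI)).
    - apply is_series_ext with (2 := Hsum). intros k. unfold plus, d; simpl.
      replace (- t) with (-1 * t) by ring. rewrite Rpow_mult_distr.
      destruct k; simpl; field; lra.
    - unfold plus, f; simpl. field. split; lra. }
  pose proof (cond_pos r) as Hr0.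
  assert (Cb : Rbar_lt 0 (CV_radius b)).
  { apply CV_radius_pos with (r / 2) (f (r / 2)); [lra|].
    apply Hb. rewrite Rabs_pos_eq; lra. }
  assert (Cd : Rbar_lt 0 (CV_radius d)).
  { apply CV_radius_pos with (1 / 2) (1 - / (1 + f (1 / 2))); [lra|].
    apply Hd. rewrite Rabs_pos_eq; lra. }
  assert (E : PS_derive b (pred n) = d (pred n)).
  { apply PSeries_ext_recip; [now rewrite CV_radius_derive | exact Cd|].
    assert (He : 0 < Rmin r 1) by (apply Rmin_pos; lra).
    exists (mkposreal _ He). intros t Ht.
    apply ball_0_Rabs in Ht; simpl in Ht.
    assert (Ht1 : Rabs t < r) by (apply Rlt_le_trans with (1 := Ht), Rmin_l).
    assert (Ht2 : Rabs t < 1) by (apply Rlt_le_trans with (1 := Ht), Rmin_r).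
    rewrite (is_pseries_unique d t _ (Hd t Ht2)).
    assert (Hcv : Rbar_lt (Rabs t) (CV_radius b)).
    { set (s := (Rabs t + r) / 2). assert (Hs : Rabs t < s < r) by (unfold s; lra).
      pose proof (Rabs_pos t).
      apply Rbar_lt_le_trans with s; [simpl; lra|].
      apply Rbar_not_lt_le. intros Hlt.
      apply (CV_disk_outside b s); [rewrite Rabs_pos_eq by lra; exact Hlt|].
      apply (ex_series_lim_0 (fun n => b n * s ^ n)). exists (f s).
      apply (proj1 (is_pseries_R b s (f s))), Hb. rewrite Rabs_pos_eq; lra. }
    rewrite <- Derive_PSeries by exact Hcv.
    assert (Hloc : locally t (fun s => PSeries b s = f s)).
    { destruct (locally_open_interval (- r) r t) as [e Hle].
      { apply Rabs_lt_between. exact Ht1. }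
      exists e. intros s Hs. apply is_pseries_unique, Hb.
      apply Rabs_lt_between, Hle, Hs. }
    rewrite (Derive_ext_loc _ f) by exact Hloc.
    assert (Hex : is_derive f t (Derive f t)).
    { apply Derive_correct. apply ex_derive_ext_loc with (PSeries b); [exact Hloc|].
      now apply ex_derive_PSeries. }
    destruct (LambertW_exp_spec t) as [H1 _]. fold (f t) in H1.
    assert (Heq : Derive f t + Derive f t * / f t = 1).
    { transitivity (Derive (fun s => f s + ln (f s)) t).
      - symmetry. apply is_derive_unique.
        apply (is_derive_plus (V := R_NormedModule) f (fun s => ln (f s))); [exact Hex|].
        apply (is_derive_comp ln f); [|exact Hex].
        now apply is_derive_ln.
      - rewrite (Derive_ext _ (fun s => s)); [apply Derive_id|].
        intros s. apply LambertW_exp_spec. }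
    replace (Derive f t) with ((Derive f t + Derive f t * / f t) * f t / (1 + f t))
      by (field; lra).
    rewrite Heq. field. lra. }
  destruct n as [|[|n]]; try lia.
  unfold PS_derive, d, b in E. cbn [pred] in *.
  rewrite E. simpl. field. lra.
Qed.

(** * Central binomial asymptotics *)

(** The central binomial coefficient of order [k] divided by [4^k]. *)
Fixpoint wallis (k : nat) : R :=
  match k with
  | O => 1
  | S j => wallis j * ((2 * INR j + 1) / (2 * INR j + 2))
  end.

Definition sin_moment (n : nat) : R := RInt (fun x => sin x ^ n) 0 (PI / 2).

Lemma continuous_sin_pow (n : nat) (x : R) : continuous (fun x => sin x ^ n) x.
Proof.
  apply (ex_derive_continuous (V := R_NormedModule)). auto_derive; trivial.
Qed.

(** The derivative of [- cos x sin^(n+1) x] is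
    [(n + 2) sin^(n+2) x - (n + 1) sin^n x], and that function vanishes at both ends. *)
Lemma sin_moment_SS (n : nat) :
  (INR n + 2) * sin_moment (S (S n)) = (INR n + 1) * sin_moment n.
Proof.
  assert (H : is_RInt (fun x => (INR n + 2) * sin x ^ S (S n) - (INR n + 1) * sin x ^ n)
                0 (PI / 2) (- (cos (PI / 2) * sin (PI / 2) ^ S n) - - (cos 0 * sin 0 ^ S n))).
  { apply (is_RInt_derive (fun x => - (cos x * sin x ^ S n))).
    - intros x _. apply is_derive_ext with (fun x => - (cos x * (sin x * sin x ^ n)));
        [reflexivity|].
      assert (Hp : is_derive (fun x => sin x ^ S n) x ((INR n + 1) * cos x * sin x ^ n)).
      { evar_last.
        - apply is_derive_pow. apply is_derive_sin.
        - rewrite S_INR. simpl. ring. }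
      evar_last.
      + apply (is_derive_opp (V := R_NormedModule)).
        apply (is_derive_mult cos (fun x => sin x ^ S n) x _ _ (is_derive_cos x) Hp).
        intros; apply Rmult_comm.
      + unfold opp, plus, mult; simpl.
        pose proof (sin2_cos2 x) as E. unfold Rsqr in E.
        replace (cos x * ((INR n + 1) * cos x * sin x ^ n))
          with ((INR n + 1) * (cos x * cos x) * sin x ^ n) by ring.
        replace (cos x * cos x) with (1 - sin x * sin x) by lra. ring.
    - intros x _. apply (continuous_minus (V := R_NormedModule));
        apply (continuous_scal_r (V := R_NormedModule)); apply continuous_sin_pow. }
  assert (K : is_RInt (fun x => (INR n + 2) * sin x ^ S (S n) - (INR n + 1) * sin x ^ n)
                0 (PI / 2) ((INR n + 2) * sin_moment (S (S n)) - (INR n + 1) * sin_moment n)).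
  { apply (is_RInt_minus (V := R_NormedModule));
      apply (is_RInt_scal (V := R_NormedModule));
      apply (RInt_correct (V := R_CompleteNormedModule));
      apply ex_RInt_everywhere; intros; apply continuous_sin_pow. }
  apply (is_RInt_unique (V := R_CompleteNormedModule)) in H.
  apply (is_RInt_unique (V := R_CompleteNormedModule)) in K. rewrite H in K.
  rewrite cos_PI2, sin_0 in K. simpl in K. lra.
Qed.

Lemma sin_moment_decr (n : nat) : sin_moment (S n) <= sin_moment n.
Proof.
  pose proof PI_RGT_0.
  apply RInt_le; [lra | | |].
  - apply ex_RInt_everywhere; intros; apply continuous_sin_pow.
  - apply ex_RInt_everywhere; intros; apply continuous_sin_pow.
  - intros x Hx. assert (0 <= sin x) by (apply sin_ge_0; lra).
    pose proof (SIN_bound x). pose proof (pow_le (sin x) n H0). simpl. nra.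
Qed.

Lemma sin_moment_nonneg (n : nat) : 0 <= sin_moment n.
Proof.
  pose proof PI_RGT_0.
  apply RInt_ge_0; [lra | |].
  - apply ex_RInt_everywhere; intros; apply continuous_sin_pow.
  - intros x Hx. apply pow_le, sin_ge_0; lra.
Qed.

Lemma sin_moment_0 : sin_moment 0 = PI / 2.
Proof.
  unfold sin_moment. simpl. rewrite RInt_const. unfold scal, mult; simpl.
  unfold mult; simpl. lra.
Qed.

Lemma sin_moment_1 : sin_moment 1 = 1.
Proof.
  apply is_RInt_unique. replace 1 with (- cos (PI / 2) - - cos 0).
  - apply (is_RInt_derive (fun x => - cos x)).
    + intros x _. auto_derive; trivial. ring.
    + intros x _. apply continuous_sin_pow.
  - rewrite cos_PI2, cos_0. ring.
Qed.

Lemma sin_moment_product (n : nat) :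
  (INR n + 1) * sin_moment n * sin_moment (S n) = PI / 2.
Proof.
  induction n as [|n IH].
  - rewrite sin_moment_0, sin_moment_1. simpl. ring.
  - rewrite S_INR. rewrite <- IH.
    transitivity (sin_moment (S n) * ((INR n + 2) * sin_moment (S (S n)))); [ring|].
    rewrite sin_moment_SS. ring.
Qed.

Lemma sin_moment_even (k : nat) : sin_moment (2 * k) = PI / 2 * wallis k.
Proof.
  induction k as [|k IH].
  - simpl (2 * 0)%nat. rewrite sin_moment_0. simpl. ring.
  - replace (2 * S k)%nat with (S (S (2 * k))) by lia.
    pose proof (sin_moment_SS (2 * k)) as H. rewrite IH, mult_INR in H.
    change (INR 2) with 2 in H. pose proof (pos_INR k).
    apply Rmult_eq_reg_l with (2 * INR k + 2); [|lra].
    rewrite H. simpl. field. lra.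
Qed.

Lemma wallis_pos (k : nat) : 0 < wallis k.
Proof.
  induction k as [|k IH]; simpl; [lra|]. pose proof (pos_INR k).
  apply Rmult_lt_0_compat; [exact IH|]. apply Rdiv_lt_0_compat; lra.
Qed.

(** Both bounds come from [(n + 1) S_n S_(n+1) = PI / 2] for the decreasing
    sequence [S_n] of the integrals of [sin^n] over a quarter period. *)
Lemma wallis_bounds (k : nat) :
  INR k * wallis k ^ 2 <= / PI <= (INR k + 1 / 2) * wallis k ^ 2.
Proof.
  pose proof PI_RGT_0 as Hpi. pose proof (pos_INR k) as Hk.
  assert (Es := sin_moment_even k).
  assert (H0 := sin_moment_nonneg (2 * k)).
  split.
  - destruct k as [|k].
    + simpl. rewrite Rmult_0_l. left; now apply Rinv_0_lt_compat.
    + assert (Hp := sin_moment_product (S (2 * k))).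
      assert (Hd := sin_moment_decr (S (2 * k))).
      replace (S (S (2 * k))) with (2 * S k)%nat in * by lia.
      rewrite !S_INR, mult_INR in *. change (INR 2) with 2 in *.
      assert (H : (2 * INR k + 1 + 1) * sin_moment (2 * S k) * sin_moment (2 * S k) <= PI / 2).
      { rewrite <- Hp. apply Rmult_le_compat_r; [exact H0|].
        apply Rmult_le_compat_l; lra. }
      rewrite Es in H.
      apply Rmult_le_reg_l with (PI * PI / 2); [nra|].
      replace (PI * PI / 2 * / PI) with (PI / 2) by (field; lra). lra.
  - assert (Hp := sin_moment_product (2 * k)).
    assert (Hd := sin_moment_decr (2 * k)).
    rewrite mult_INR in Hp. change (INR 2) with 2 in Hp.
    assert (H : PI / 2 <= (2 * INR k + 1) * sin_moment (2 * k) * sin_moment (2 * k)).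
    { rewrite <- Hp. apply Rmult_le_compat_l; [|exact Hd]. nra. }
    rewrite Es in H.
    apply Rmult_le_reg_l with (PI * PI / 2); [nra|].
    replace (PI * PI / 2 * / PI) with (PI / 2) by (field; lra). lra.
Qed.

(** From [n x^2 <= 1 / PI = (n + 1) y^2], where [x] is [wallis n] and
    [y = 1 / sqrt (PI (n + 1))], one gets [n (x^2 - y^2) <= y^2]. *)
Lemma wallis_sqrt (n : nat) : (1 <= n)%nat ->
  Rabs (wallis n - / sqrt (PI * (INR n + 1))) <= / (INR n * sqrt (INR n + 1)).
Proof.
  intros Hn. apply le_INR in Hn. change (INR 1) with 1 in Hn.
  pose proof PI2_1 as Hpi.
  destruct (wallis_bounds n) as [H1 H2].
  pose proof (wallis_pos n) as Hw. set (x := wallis n) in *.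
  set (m := INR n) in *.
  assert (Hs : 0 < sqrt (PI * (m + 1))) by (apply sqrt_lt_R0; nra).
  set (y := / sqrt (PI * (m + 1))).
  assert (Hy : 0 < y) by now apply Rinv_0_lt_compat.
  assert (Hy2 : y * y = / PI * / (m + 1)).
  { unfold y. rewrite <- Rinv_mult, sqrt_sqrt by nra. now rewrite Rinv_mult. }
  assert (Hm : (m + 1) * (y * y) = / PI) by (rewrite Hy2; field; lra).
  assert (Hxy : y <= x).
  { destruct (Rle_lt_dec y x) as [|Hlt]; trivial. exfalso.
    assert (x ^ 2 < y * y) by nra. nra. }
  rewrite Rabs_pos_eq by lra.
  assert (Hq : 0 < sqrt (m + 1)) by (apply sqrt_lt_R0; lra).
  assert (Hqq : sqrt (m + 1) * sqrt (m + 1) = m + 1) by (apply sqrt_sqrt; lra).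
  assert (Hyq : y * sqrt (m + 1) <= 1).
  { unfold y. rewrite sqrt_mult by lra.
    assert (1 <= sqrt PI) by (rewrite <- sqrt_1; apply sqrt_le_1; lra).
    apply Rmult_le_reg_l with (sqrt PI * sqrt (m + 1)); [nra|].
    replace (sqrt PI * sqrt (m + 1) * (/ (sqrt PI * sqrt (m + 1)) * sqrt (m + 1)))
      with (sqrt (m + 1)) by (field; lra). nra. }
  apply Rmult_le_reg_l with (m * sqrt (m + 1)); [nra|].
  rewrite Rinv_r by nra.
  (* m (x - y) y <= m (x^2 - y^2) <= y^2 *)
  assert (Hb : m * ((x - y) * y) <= y * y).
  { assert (m * (x * x) <= (m + 1) * (y * y)) by nra. nra. }
  assert (Hb' : m * (x - y) <= y).
  { apply Rmult_le_reg_r with y; [exact Hy|]. lra. }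
  apply Rle_trans with (y * sqrt (m + 1)); [|exact Hyq].
  replace (m * sqrt (m + 1) * (x - y)) with (m * (x - y) * sqrt (m + 1)) by ring.
  apply Rmult_le_compat_r; lra.
Qed.

(** * The quadratic model *)

Definition c_sym_integral (F : R -> C) (l : C) : Prop :=
  sym_integral (fun x => Re (F x)) (Re l) /\ sym_integral (fun x => Im (F x)) (Im l).

Lemma c_sym_integral_val (F : R -> C) (l m : C) :
  c_sym_integral F l -> l = m -> c_sym_integral F m.
Proof. now intros H <-. Qed.

Lemma c_sym_integral_ext (F G : R -> C) (l : C) :
  (forall x, F x = G x) -> c_sym_integral F l -> c_sym_integral G l.
Proof.
  intros E [H1 H2]; split; eapply sym_integral_ext; try eassumption;
    intros x; simpl; now rewrite E.
Qed.

Lemma c_sym_integral_plus (F G : R -> C) (l m : C) :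
  c_continuous F -> c_continuous G -> c_sym_integral F l -> c_sym_integral G m ->
  c_sym_integral (fun x => F x + G x)%C (l + m)%C.
Proof.
  intros [F1 F2] [G1 G2] [H1 H2] [K1 K2]; split.
  - replace (Re (l + m)%C) with (1 * Re l + 1 * Re m) by (unfold Re; simpl; ring).
    eapply sym_integral_ext;
      [|apply (sym_integral_lin _ _ 1 1 _ _ F1 G1 H1 K1)].
    intros x; unfold Re; simpl; ring.
  - replace (Im (l + m)%C) with (1 * Im l + 1 * Im m) by (unfold Im; simpl; ring).
    eapply sym_integral_ext;
      [|apply (sym_integral_lin _ _ 1 1 _ _ F2 G2 H2 K2)].
    intros x; unfold Im; simpl; ring.
Qed.

Lemma c_sym_integral_scal (c : C) (F : R -> C) (l : C) :
  c_continuous F -> c_sym_integral F l -> c_sym_integral (fun x => c * F x)%C (c * l)%C.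
Proof.
  intros [F1 F2] [H1 H2]; split.
  - replace (Re (c * l)%C) with (Re c * Re l + - Im c * Im l) by (unfold Re, Im; simpl; ring).
    eapply sym_integral_ext;
      [|apply (sym_integral_lin _ _ (Re c) (- Im c) _ _ F1 F2 H1 H2)].
    intros x; unfold Re, Im; simpl; ring.
  - replace (Im (c * l)%C) with (Re c * Im l + Im c * Re l) by (unfold Re, Im; simpl; ring).
    eapply sym_integral_ext;
      [|apply (sym_integral_lin _ _ (Re c) (Im c) _ _ F2 F1 H2 H1)].
    intros x; unfold Re, Im; simpl; ring.
Qed.

Lemma is_lim_seq_rate (u : nat -> R) (l K B : R) :
  (forall n, B <= INR n -> 0 < INR n -> Rabs (u n - l) <= K / INR n) -> is_lim_seq u l.
Proof.
  intros H. apply is_lim_seq_eps. intros eps He.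
  exists (Rmax B (Rmax 1 (K / eps))). intros n Hn.
  pose proof (Rmax_l B (Rmax 1 (K / eps))). pose proof (Rmax_r B (Rmax 1 (K / eps))).
  pose proof (Rmax_l 1 (K / eps)). pose proof (Rmax_r 1 (K / eps)).
  apply Rle_trans with (K / INR n); [apply H; lra|].
  apply Rmult_le_reg_r with (INR n); [lra|].
  unfold Rdiv. rewrite Rmult_assoc, Rinv_l by lra. rewrite Rmult_1_r.
  replace K with (eps * (K / eps)) by (field; lra).
  apply Rmult_le_compat_l; lra.
Qed.

Lemma c_sym_integral_derive (F F' : R -> C) (l : C) (K B : R) :
  (forall x, c_derive F x (F' x)) -> c_continuous F' ->
  (forall n, B <= INR n -> 0 < INR n ->
     Cmod (F (INR n) - F (- INR n) - l) <= K / INR n) ->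
  c_sym_integral F' l.
Proof.
  intros HF [C1 C2] HK; split.
  - apply is_lim_seq_ext with (fun N => Re (F (INR N)) - Re (F (- INR N))).
    { intros N. symmetry. apply is_RInt_unique.
      apply (is_RInt_derive (fun x => Re (F x))); intros; [apply HF | apply C1]. }
    apply is_lim_seq_rate with K B. intros n H1 H2.
    eapply Rle_trans; [|apply (HK n H1 H2)].
    eapply Rle_trans; [|apply re_le_Cmod]. right; f_equal; unfold Re; simpl; ring.
  - apply is_lim_seq_ext with (fun N => Im (F (INR N)) - Im (F (- INR N))).
    { intros N. symmetry. apply is_RInt_unique.
      apply (is_RInt_derive (fun x => Im (F x))); intros; [apply HF | apply C2]. }
    apply is_lim_seq_rate with K B. intros n H1 H2.
    eapply Rle_trans; [|apply (HK n H1 H2)].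
    eapply Rle_trans; [|apply im_le_Cmod]. right; f_equal; unfold Im; simpl; ring.
Qed.

(** [kernel] with [e^u - u] replaced by its second-order expansion at its
    minimum [u = 0]. *)
Definition model (u : R) : C := (1 + u ^ 2 / 2, - PI).

Lemma model_Cmod_sqr (u : R) : 1 + PI ^ 2 + u ^ 2 / 2 <= Cmod (model u) ^ 2.
Proof.
  rewrite Cmod2_alt. unfold model, Re, Im; cbn [fst snd]. nra.
Qed.

Lemma model_Cmod_ge_1 (u : R) : 1 <= Cmod (model u).
Proof.
  pose proof (model_Cmod_sqr u). pose proof (Cmod_ge_0 (model u)).
  pose proof PI2_1. nra.
Qed.

Lemma model_neq_0 (u : R) : model u <> RtoC 0.
Proof. apply Cmod_gt_0. pose proof (model_Cmod_ge_1 u); lra. Qed.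

Lemma c_derive_model (u : R) : c_derive model u u.
Proof. split; unfold Re, Im; simpl; auto_derive; trivial; field. Qed.

Lemma c_continuous_inv_model_pow (n : nat) :
  c_continuous (fun u => / model u ^ n)%C.
Proof.
  apply c_continuous_inv.
  - intros u. eexists. apply c_derive_pow, c_derive_model.
  - intros u. apply Cpow_nz, model_neq_0.
Qed.

Definition cis (x : R) : C := (cos x, sin x).

Lemma cis_plus (x y : R) : cis (x + y) = (cis x * cis y)%C.
Proof.
  unfold cis, Cmult; simpl. rewrite cos_plus, sin_plus. f_equal; ring.
Qed.

(** [1 + i PI] is [rho] times [cis theta], and the two singularities of [W(e^t)]
    nearest to [0] are [-1 - i PI] and [-1 + i PI]. *)
Definition rho : R := sqrt (1 + PI ^ 2).

Definition theta : R := atan PI.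

Lemma rho_pos : 0 < rho.
Proof. apply sqrt_lt_R0. pose proof (pow2_ge_0 PI); lra. Qed.

Lemma rho_sqr : rho ^ 2 = 1 + PI ^ 2.
Proof. unfold rho. rewrite pow2_sqrt; trivial. pose proof (pow2_ge_0 PI); lra. Qed.

Lemma rho_cis_theta : rho * cos theta = 1 /\ rho * sin theta = PI.
Proof.
  unfold theta. rewrite cos_atan, sin_atan. unfold Rsqr.
  replace (1 + PI * PI) with (1 + PI ^ 2) by ring. fold rho.
  pose proof rho_pos. split; field; lra.
Qed.

Definition model_min : C := (1, - PI).

Lemma model_0_polar : (model_min * cis theta)%C = RtoC rho.
Proof.
  destruct rho_cis_theta as [H1 H2]. pose proof rho_pos.
  unfold model_min, cis, Cmult, RtoC; simpl. pose proof (sin2_cos2 theta) as E. unfold Rsqr in E.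
  f_equal.
  - rewrite <- H2. rewrite <- H1 at 1.
    transitivity (rho * (sin theta * sin theta + cos theta * cos theta)); [ring|].
    rewrite E; ring.
  - rewrite <- H2. rewrite <- H1 at 1. ring.
Qed.

(** Integration by parts, through [d/du (u / model^n)]. *)
Lemma c_sym_integral_model_S (n : nat) (l : C) : (1 <= n)%nat ->
  c_sym_integral (fun u => / model u ^ n)%C l ->
  c_sym_integral (fun u => / model u ^ S n)%C
    (RtoC ((2 * INR n - 1) / (2 * INR n * rho)) * cis theta * l)%C.
Proof.
  intros Hn Hl.
  assert (Hn' : 1 <= INR n) by (apply (le_INR 1); exact Hn).
  pose proof rho_pos as Hr.
  set (D := fun u => (RtoC (1 - 2 * INR n) * / model u ^ n
                      + RtoC (2 * INR n) * model_min * / model u ^ S n)%C).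
  assert (HD : c_sym_integral D 0).
  { apply c_sym_integral_derive with (fun u : R => (RtoC u * / model u ^ n)%C) 4 1.
    - intros u. eapply c_derive_val.
      + apply c_derive_mult.
        * apply (c_derive_real (fun u : R => u) u 1). apply (is_derive_id (K := R_AbsRing)).
        * apply c_derive_inv; [apply c_derive_pow, c_derive_model|].
          apply Cpow_nz, model_neq_0.
      + assert (E : model_min = (model u - RtoC (u ^ 2 / 2))%C).
        { unfold model_min, model, RtoC, Cminus, Cplus, Copp; simpl. f_equal; ring. }
        unfold D. rewrite E. destruct n as [|m]; [lia|]. cbn [pred].
        rewrite !Cpow_S.
        assert (E2 : RtoC (u ^ 2 / 2) = (u * u / 2)%C).
        { rewrite RtoC_div, RtoC_pow by lra. now rewrite Cpow_S, Cpow_1_r. }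
        rewrite E2, RtoC_minus, RtoC_mult.
        pose proof (model_neq_0 u) as H1. pose proof (Cpow_nz _ m H1) as H2.
        assert (H3 : RtoC 2 <> RtoC 0) by (intros E3; apply RtoC_inj in E3; lra).
        field. repeat split; trivial.
    - apply c_derive_continuous. intros u. eexists.
      apply c_derive_plus; (apply c_derive_mult; [apply c_derive_const|]);
        (apply c_derive_inv; [apply c_derive_pow, c_derive_model
                             | apply Cpow_nz, model_neq_0]).
    - intros N _ HN.
      assert (E : model (- INR N) = model (INR N)).
      { unfold model. f_equal. field. }
      rewrite E, RtoC_opp.
      replace (INR N * / model (INR N) ^ n - (- RtoC (INR N)) * / model (INR N) ^ n - 0)%C
        with (RtoC 2 * (INR N * / model (INR N) ^ n))%C by ring.
      rewrite !Cmod_mult, !Cmod_R, Cmod_inv, Cmod_pow by apply Cpow_nz, model_neq_0.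
      rewrite (Rabs_pos_eq 2), (Rabs_pos_eq (INR N)) by lra.
      assert (Hm : INR N ^ 2 / 2 <= Cmod (model (INR N)) ^ n).
      { destruct n as [|m]; [lia|].
        apply Rle_trans with (Cmod (model (INR N))); [|apply pow_ge_factor, model_Cmod_ge_1].
        eapply Rle_trans; [|apply re_le_Cmod].
        unfold model, Re; cbn [fst]. rewrite Rabs_pos_eq; nra. }
      apply Rle_trans with (2 * (INR N * / (INR N ^ 2 / 2))).
      + apply Rmult_le_compat_l; [lra|]. apply Rmult_le_compat_l; [lra|].
        apply Rinv_le_contravar; [nra | exact Hm].
      + right. field. lra. }
  assert (Hz : model_min <> RtoC 0).
  { intros E. apply (f_equal Re) in E. simpl in E. lra. }
  assert (Hcis : cis theta = (RtoC rho / model_min)%C).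
  { rewrite <- model_0_polar. field. exact Hz. }
  assert (H2n : RtoC (2 * INR n) <> RtoC 0).
  { intros E; apply RtoC_inj in E; lra. }
  assert (Hrho : RtoC rho <> RtoC 0).
  { intros E; apply RtoC_inj in E; lra. }
  set (c := (/ (RtoC (2 * INR n) * model_min))%C).
  apply c_sym_integral_ext with (fun u => c * (D u + RtoC (2 * INR n - 1) * / model u ^ n))%C.
  { intros u. unfold c, D. rewrite !RtoC_minus.
    pose proof (model_neq_0 u) as H1. rewrite Cpow_S. pose proof (Cpow_nz _ n H1).
    field. repeat split; trivial. }
  assert (HDc : c_continuous D).
  { apply c_derive_continuous. intros u. eexists.
    apply c_derive_plus; (apply c_derive_mult; [apply c_derive_const|]);
      (apply c_derive_inv; [apply c_derive_pow, c_derive_model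
                           | apply Cpow_nz, model_neq_0]). }
  assert (HMc : c_continuous (fun u => RtoC (2 * INR n - 1) * / model u ^ n)%C).
  { apply c_derive_continuous. intros u. eexists.
    apply c_derive_mult; [apply c_derive_const|].
    apply c_derive_inv; [apply c_derive_pow, c_derive_model | apply Cpow_nz, model_neq_0]. }
  eapply c_sym_integral_val.
  - apply c_sym_integral_scal.
    + apply c_derive_continuous. intros u. eexists.
      apply c_derive_plus; [apply c_derive_plus|]; (apply c_derive_mult; [apply c_derive_const|]);
        (apply c_derive_inv; [apply c_derive_pow, c_derive_model
                             | apply Cpow_nz, model_neq_0]).
    + apply c_sym_integral_plus; [exact HDc | exact HMc | exact HD |].
      apply c_sym_integral_scal; [apply c_continuous_inv_model_pow | exact Hl].
  - unfold c. rewrite Hcis, RtoC_div by nra. rewrite (RtoC_mult (2 * INR n) rho).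
    field. repeat split; trivial.
Qed.

Lemma theta_bounds : 0 < theta < PI / 2.
Proof.
  unfold theta. split.
  - rewrite <- atan_0. apply atan_increasing, PI_RGT_0.
  - apply atan_bound.
Qed.

Lemma ln_diff_le (x y : R) : 0 < x -> x <= y -> 0 <= ln y - ln x <= (y - x) / x.
Proof.
  intros Hx Hxy. split.
  - destruct Hxy as [H | ->]; [pose proof (ln_increasing _ _ Hx H); lra | lra].
  - rewrite <- ln_div by lra.
    assert (Hq : 0 < y / x) by (apply Rdiv_lt_0_compat; lra).
    pose proof (exp_ineq1_le (ln (y / x))) as H. rewrite exp_ln in H by exact Hq.
    replace ((y - x) / x) with (y / x - 1) by (field; lra). lra.
Qed.

(** Partial fractions over the two roots [q] and [- q] of the quadratic [model];
    the logarithm of [(u - q) / (u + q)] gains [2 PI i] along the line. *)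
Lemma c_sym_integral_model_1 :
  c_sym_integral (fun u => / model u)%C
    (RtoC (2 * PI / sqrt (2 * rho)) * cis (theta / 2))%C.
Proof.
  pose proof rho_pos as Hr. pose proof theta_bounds as Ht. pose proof PI_RGT_0 as Hpi.
  set (s := sqrt (2 * rho)).
  assert (Hs : 0 < s) by (apply sqrt_lt_R0; lra).
  assert (Hs2 : s * s = 2 * rho) by (apply sqrt_sqrt; lra).
  set (al := s * cos (theta / 2)). set (be := s * sin (theta / 2)).
  assert (Hal : 0 < al).
  { apply Rmult_lt_0_compat; [exact Hs | apply cos_gt_0; lra]. }
  assert (Hbe : 0 < be).
  { apply Rmult_lt_0_compat; [exact Hs | apply sin_gt_0; lra]. }
  destruct rho_cis_theta as [Hc Hsn].
  assert (Hab : al * al - be * be = 2).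
  { unfold al, be. transitivity (2 * (rho * cos theta)); [|lra].
    replace (cos theta) with (cos (2 * (theta / 2))) by (f_equal; field).
    rewrite cos_2a. transitivity (s * s * (cos (theta / 2) * cos (theta / 2)
        - sin (theta / 2) * sin (theta / 2))); [ring | rewrite Hs2; ring]. }
  assert (Hab2 : al * be = PI).
  { unfold al, be. rewrite <- Hsn.
    replace (sin theta) with (sin (2 * (theta / 2))) by (f_equal; field).
    rewrite sin_2a. transitivity (s * s * (sin (theta / 2) * cos (theta / 2)));
      [ring | rewrite Hs2; ring]. }
  set (q := (be, al) : C).
  assert (Hq : q <> RtoC 0).
  { intros E. apply (f_equal Im) in E. simpl in E. lra. }
  assert (Hfac : forall u : R, model u = (((u - q) * (u + q)) / 2)%C).
  { intros u. assert (E : (RtoC 2 * model u)%C = ((u - q) * (u + q))%C).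
    { unfold model, q, RtoC, Cminus, Cplus, Copp, Cmult; simpl. f_equal; [nra | lra]. }
    rewrite <- E. now field. }
  assert (Hmq : forall u : R, (u - q)%C <> RtoC 0).
  { intros u E. apply (f_equal Im) in E. simpl in E. lra. }
  assert (Hpq : forall u : R, (u + q)%C <> RtoC 0).
  { intros u E. apply (f_equal Im) in E. simpl in E. lra. }
  set (L := fun u : R => ((ln ((u - be) ^ 2 + al ^ 2) - ln ((u + be) ^ 2 + al ^ 2)) / 2,
                      atan ((u - be) / al) + atan ((u + be) / al)) : C).
  assert (HL : forall u, c_derive L u (/ (u - q) - / (u + q))%C).
  { intros u.
    assert (0 < (u - be) ^ 2 + al ^ 2) by nra.
    assert (0 < (u + be) ^ 2 + al ^ 2) by nra.
    split.
    - unfold L, Re at 1; cbn [fst]. auto_derive; [repeat split; trivial; nra|].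
      unfold q, Re, RtoC, Cminus, Cplus, Copp, Cinv; simpl.
      field. repeat split; apply Rgt_not_eq; nra.
    - unfold L, Im at 1; cbn [snd]. auto_derive; [repeat split; trivial; lra|].
      unfold q, Im, RtoC, Cminus, Cplus, Copp, Cinv, Rsqr; simpl.
      field. repeat split; try apply Rgt_not_eq; nra. }
  assert (HLc : c_continuous (fun u : R => / (u - q) - / (u + q))%C).
  { apply c_derive_continuous. intros u. eexists.
    apply (c_derive_plus (fun u : R => / (u - q))%C (fun u : R => - / (u + q))%C).
    - apply (c_derive_inv (fun u : R => u - q)%C); [|apply Hmq].
      apply (c_derive_plus (fun u : R => RtoC u) (fun _ => - q)%C);
        [apply (c_derive_real (fun u : R => u) u 1), (is_derive_id (K := R_AbsRing))
        | apply c_derive_const].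
    - apply c_derive_ext with (fun u : R => (- RtoC 1) * / (u + q))%C.
      { intros v. ring. }
      apply c_derive_mult; [apply c_derive_const|].
      apply (c_derive_inv (fun u : R => u + q)%C); [|apply Hpq].
      apply (c_derive_plus (fun u : R => RtoC u) (fun _ => q)%C);
        [apply (c_derive_real (fun u : R => u) u 1), (is_derive_id (K := R_AbsRing))
        | apply c_derive_const]. }
  assert (HI : c_sym_integral (fun u : R => / (u - q) - / (u + q))%C (0, 2 * PI)).
  { apply c_sym_integral_derive with L (16 * be + 6 * al) (2 * be); [exact HL | exact HLc|].
    intros n H1 H2. set (N := INR n) in *.
    set (X := (N - be) ^ 2 + al ^ 2). set (Y := (N + be) ^ 2 + al ^ 2).
    assert (HX : N ^ 2 / 4 <= X) by (unfold X; nra).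
    assert (HXY : Y - X = 4 * N * be) by (unfold X, Y; ring).
    assert (HX0 : 0 < X) by nra.
    destruct (ln_diff_le X Y HX0 ltac:(nra)) as [K1 K2].
    assert (HP : forall z, N / 2 <= z -> 0 <= PI / 2 - atan (z / al) <= 2 * al / N).
    { intros z Hz. assert (0 < z / al) by (apply Rdiv_lt_0_compat; lra).
      destruct (atan_tail (z / al)) as [J1 J2]; trivial. split; [exact J1|].
      apply Rle_trans with (1 := J2).
      replace (/ (z / al)) with (al * / z) by (field; lra).
      replace (2 * al / N) with (al * / (N / 2)) by (field; lra).
      apply Rmult_le_compat_l; [lra|]. apply Rinv_le_contravar; lra. }
    assert (P1 := HP (N - be) ltac:(lra)). assert (P2 := HP (N + be) ltac:(lra)).
    assert (E : Cminus (Cminus (L N) (L (- N))) (0, 2 * PI) =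
              ((ln X - ln Y), 2 * (atan ((N - be) / al) + atan ((N + be) / al)) - 2 * PI)).
    { unfold L, Cminus, Cplus, Copp; cbn [fst snd].
      replace ((- N - be) ^ 2 + al ^ 2) with Y by (unfold Y; ring).
      replace ((- N + be) ^ 2 + al ^ 2) with X by (unfold X; ring).
      fold X Y.
      replace ((- N - be) / al) with (- ((N + be) / al)) by (field; lra).
      replace ((- N + be) / al) with (- ((N - be) / al)) by (field; lra).
      rewrite !atan_opp. f_equal; field. }
    rewrite E. eapply Rle_trans; [apply Cmod_pair_le|].
    rewrite (Rabs_left1 (ln X - ln Y)) by lra.
    rewrite Rabs_left1 by lra.
    assert (K3 : (Y - X) / X <= 16 * be / N).
    { rewrite HXY.
      apply Rle_trans with (4 * N * be * / (N ^ 2 / 4)).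
      - apply Rmult_le_compat_l; [nra|]. apply Rinv_le_contravar; nra.
      - right. field. lra. }
    replace ((16 * be + 6 * al) / N) with (16 * be / N + 3 * (2 * al / N)) by (field; lra).
    assert (P3 : PI / 2 - atan ((N + be) / al) <= al / N).
    { assert (Hz : 0 < (N + be) / al) by (apply Rdiv_lt_0_compat; lra).
      destruct (atan_tail _ Hz) as [_ J2]. apply Rle_trans with (1 := J2).
      replace (/ ((N + be) / al)) with (al * / (N + be)) by (field; lra).
      apply Rmult_le_compat_l; [lra|]. apply Rinv_le_contravar; lra. }
    replace (2 * al / N) with (2 * (al / N)) in * by (field; lra). lra. }
  apply c_sym_integral_ext with (fun u : R => / q * (/ (u - q) - / (u + q)))%C.
  { intros u. rewrite Hfac. specialize (Hmq u). specialize (Hpq u). field.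
    repeat split; trivial. }
  eapply c_sym_integral_val.
  - apply c_sym_integral_scal; [exact HLc | exact HI].
  - assert (E : ((0, (2 * PI)%R) : C) =
              (q * (RtoC (2 * PI / s) * cis (theta / 2)))%C).
    { unfold q, cis, RtoC, Cmult, al, be; simpl.
      pose proof (sin2_cos2 (theta / 2)) as E. unfold Rsqr in E.
      f_equal.
      - field. lra.
      - transitivity (2 * PI * (sin (theta / 2) * sin (theta / 2)
          + cos (theta / 2) * cos (theta / 2))); [rewrite E; ring | field; lra]. }
    rewrite E. field. exact Hq.
Qed.

(** The value at exponent [1] and the recurrence over the exponent give the
    integrals of the powers [model^(-n)] as central binomial coefficients times powers of [model_min],
    the same numbers as the coefficients of an inverse square root. *)
Theorem c_sym_integral_model (m : nat) :
  c_sym_integral (fun u => / model u ^ S m)%C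
    (RtoC (wallis m * (2 * PI / sqrt (2 * rho)) / rho ^ m)
     * cis (theta / 2 + INR m * theta))%C.
Proof.
  pose proof rho_pos as Hr.
  assert (Hs : 0 < sqrt (2 * rho)) by (apply sqrt_lt_R0; lra).
  induction m as [|m IH].
  - apply c_sym_integral_ext with (fun u => / model u)%C.
    { intros u. now rewrite Cpow_1_r. }
    eapply c_sym_integral_val; [apply c_sym_integral_model_1|].
    f_equal; f_equal; simpl; [field; lra | ring].
  - eapply c_sym_integral_val.
    + apply (c_sym_integral_model_S (S m)); [lia | exact IH].
    + replace (theta / 2 + INR (S m) * theta)
        with (theta + (theta / 2 + INR m * theta)) by (rewrite S_INR; ring).
      rewrite (cis_plus theta).
      replace (wallis (S m) * (2 * PI / sqrt (2 * rho)) / rho ^ S m) with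
        ((2 * INR (S m) - 1) / (2 * INR (S m) * rho) *
         (wallis m * (2 * PI / sqrt (2 * rho)) / rho ^ m)).
      * rewrite (RtoC_mult (_ / _)). ring.
      * rewrite S_INR. pose proof (pos_INR m). pose proof (pow_lt rho m Hr). 
        simpl. field. repeat split; lra.
Qed.

(** * Comparison of the kernel with its quadratic model *)

Lemma exp_sub_1_small (y : R) : Rabs y <= 1 -> Rabs (exp y - 1) <= 3 * Rabs y.
Proof.
  intros Hy.
  destruct (MVT_segment (fun s => exp (s * y)) (fun s => y * exp (s * y))) as [c [Hc E]].
  { intros s; auto_derive; trivial; ring. }
  rewrite Rmult_1_l, Rmult_0_l, exp_0 in E. rewrite E, Rabs_mult.
  rewrite (Rmult_comm 3). apply Rmult_le_compat_l; [apply Rabs_pos|].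
  rewrite Rabs_pos_eq by (left; apply exp_pos).
  apply Rle_trans with (1 := exp_scale_le 1 y c Hy Hc). exact exp_le_3.
Qed.

Lemma exp_taylor_1_small (y : R) : Rabs y <= 1 -> Rabs (exp y - 1 - y) <= 3 * Rabs y ^ 2.
Proof.
  intros Hy.
  destruct (MVT_segment (fun s => exp (s * y) - s * y) (fun s => y * (exp (s * y) - 1)))
    as [c [Hc E]].
  { intros s; auto_derive; trivial; ring. }
  rewrite Rmult_1_l, Rmult_0_l, exp_0 in E.
  replace (exp y - 1 - y) with (y * (exp (c * y) - 1)) by lra.
  rewrite Rabs_mult.
  assert (Hcy : Rabs (c * y) <= Rabs y).
  { rewrite Rabs_mult, (Rabs_pos_eq c) by lra. pose proof (Rabs_pos y). nra. }
  pose proof (exp_sub_1_small (c * y) ltac:(lra)). pose proof (Rabs_pos y). nra.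
Qed.

Lemma exp_taylor_2_small (u : R) : Rabs u <= 1 ->
  Rabs (exp u - 1 - u - u ^ 2 / 2) <= 3 * Rabs u ^ 3.
Proof.
  intros Hu.
  destruct (MVT_segment (fun s => exp (s * u) - s * u - (s * u) ^ 2 / 2)
    (fun s => u * (exp (s * u) - 1 - s * u))) as [c [Hc E]].
  { intros s; auto_derive; trivial; field. }
  rewrite !Rmult_1_l, !Rmult_0_l, exp_0 in E.
  replace (exp u - 1 - u - u ^ 2 / 2) with (u * (exp (c * u) - 1 - c * u)) by lra.
  rewrite Rabs_mult.
  assert (Hcy : Rabs (c * u) <= Rabs u).
  { rewrite Rabs_mult, (Rabs_pos_eq c) by lra. pose proof (Rabs_pos u). nra. }
  pose proof (exp_taylor_1_small (c * u) ltac:(lra)) as H.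
  pose proof (Rabs_pos u). pose proof (Rabs_pos (c * u)).
  assert (Rabs (c * u) ^ 2 <= Rabs u ^ 2) by nra.
  replace (3 * Rabs u ^ 3) with (Rabs u * (3 * Rabs u ^ 2)) by ring.
  apply Rmult_le_compat_l; lra.
Qed.

(** Beyond [|u| = 1] the exponentially large difference is absorbed by the
    product of the moduli in the denominator. *)
Lemma kernel_model_inv_close (u : R) :
  Cmod (/ kernel u - / model u) <= 3 * Rabs u ^ 3.
Proof.
  pose proof (kernel_Cmod_ge_2 u) as HK. pose proof (model_Cmod_ge_1 u) as HM.
  pose proof (kernel_neq_0 u) as HK0. pose proof (model_neq_0 u) as HM0.
  pose proof (Rabs_pos u) as Hu.
  replace (/ kernel u - / model u)%C
    with ((model u - kernel u) * / (kernel u * model u))%C by (field; now split).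
  rewrite Cmod_mult, Cmod_inv, Cmod_mult by now apply Cmult_neq_0.
  apply Rmult_le_reg_r with (Cmod (kernel u) * Cmod (model u)); [nra|].
  rewrite Rmult_assoc, Rinv_l, Rmult_1_r by nra.
  destruct (Rle_lt_dec (Rabs u) 1) as [H1 | H1].
  - replace (model u - kernel u)%C with (RtoC (- (exp u - 1 - u - u ^ 2 / 2))).
    + rewrite Cmod_R, Rabs_Ropp. pose proof (exp_taylor_2_small u H1).
      assert (0 <= 3 * Rabs u ^ 3) by (pose proof (pow_le _ 3 Hu); lra).
      assert (1 <= Cmod (kernel u) * Cmod (model u)) by nra. nra.
    + unfold model, kernel, RtoC, Cminus, Cplus, Copp; simpl. f_equal; field.
  - unfold Cminus. eapply Rle_trans; [apply Cmod_triangle|]. rewrite Cmod_opp.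
    assert (1 <= Rabs u ^ 3) by (apply pow_R1_Rle; lra).
    assert (Cmod (model u) + Cmod (kernel u) <= 3 * (Cmod (kernel u) * Cmod (model u))) by nra.
    nra.
Qed.

Lemma Cpow_sub_le (x y : C) (q : R) (n : nat) : Cmod x <= q -> Cmod y <= q ->
  Cmod (x ^ S n - y ^ S n) <= INR (S n) * Cmod (x - y) * q ^ n.
Proof.
  intros Hx Hy. pose proof (Cmod_ge_0 x). pose proof (Cmod_ge_0 y).
  pose proof (Cmod_ge_0 (x - y)) as Hd.
  induction n as [|n IH].
  - rewrite !Cpow_1_r. simpl. lra.
  - rewrite (Cpow_S x), (Cpow_S y).
    replace (x * x ^ S n - y * y ^ S n)%C
      with (x * (x ^ S n - y ^ S n) + (x - y) * y ^ S n)%C by ring.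
    eapply Rle_trans; [apply Cmod_triangle|].
    rewrite !Cmod_mult, Cmod_pow, (S_INR (S n)).
    assert (Cmod y ^ S n <= q ^ S n) by (apply pow_incr; lra).
    pose proof (Cmod_ge_0 (x ^ S n - y ^ S n)).
    assert (Cmod x * Cmod (x ^ S n - y ^ S n) <= q * (INR (S n) * Cmod (x - y) * q ^ n)).
    { apply Rmult_le_compat; lra. }
    replace ((INR (S n) + 1) * Cmod (x - y) * q ^ S n)
      with (q * (INR (S n) * Cmod (x - y) * q ^ n) + Cmod (x - y) * q ^ S n) by (simpl; ring).
    apply Rplus_le_compat; [lra|]. now apply Rmult_le_compat_l.
Qed.

(** A lower bound of both [|kernel|] and [|model|], equal to them at [u = 0]:
    the differences of powers decay like the powers themselves. *)
Definition common_modulus (u : R) : R := sqrt (1 + PI ^ 2 + u ^ 2 / 2).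

Lemma common_modulus_pos (u : R) : 0 < common_modulus u.
Proof. apply sqrt_lt_R0. pose proof (pow2_ge_0 PI). nra. Qed.

Lemma common_modulus_sqr (u : R) : common_modulus u ^ 2 = 1 + PI ^ 2 + u ^ 2 / 2.
Proof. unfold common_modulus. rewrite pow2_sqrt; trivial. pose proof (pow2_ge_0 PI). nra. Qed.

Lemma common_modulus_le (u x : R) :
  0 <= x -> 1 + PI ^ 2 + u ^ 2 / 2 <= x ^ 2 -> common_modulus u <= x.
Proof.
  intros Hx H. rewrite <- (sqrt_pow2 x Hx). apply sqrt_le_1_alt. exact H.
Qed.

Lemma Im_pow_difference_le (n : nat) (u : R) :
  Rabs (Im (/ kernel u ^ S n)%C - Im (/ model u ^ S n)%C) <=
  3 * INR (S n) * Rabs u ^ 3 * / common_modulus u ^ n.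
Proof.
  pose proof (common_modulus_pos u) as Hc.
  pose proof (kernel_neq_0 u) as HK0. pose proof (model_neq_0 u) as HM0.
  replace (Im (/ kernel u ^ S n)%C - Im (/ model u ^ S n)%C)
    with (Im ((/ kernel u) ^ S n - (/ model u) ^ S n)%C)
    by (rewrite !Cpow_inv by trivial; unfold Im; simpl; ring).
  eapply Rle_trans; [apply im_le_Cmod|].
  eapply Rle_trans.
  - apply (Cpow_sub_le _ _ (/ common_modulus u)); rewrite Cmod_inv by trivial;
      (apply Rinv_le_contravar; [exact Hc | apply common_modulus_le; [apply Cmod_ge_0|]]).
    + apply kernel_Cmod_sqr.
    + apply model_Cmod_sqr.
  - rewrite pow_inv.
    assert (0 < / common_modulus u ^ n) by (apply Rinv_0_lt_compat, pow_lt, Hc).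
    apply Rmult_le_compat_r; [lra|].
    pose proof (kernel_model_inv_close u). pose proof (pos_INR (S n)). nra.
Qed.

(** The substitution [r = common_modulus u] turns the integral of
    [u^3 / r^(j+5)] into that of [4 / r^(j+2) - 4 (1 + PI^2) / r^(j+4)]. *)
Definition cubic_primitive (j : nat) (u : R) : R :=
  4 * (1 + PI ^ 2) / (INR j + 3) * / common_modulus u ^ (j + 3)
  - 4 / (INR j + 1) * / common_modulus u ^ (j + 1).

Lemma is_derive_cubic_primitive (j : nat) (u : R) :
  is_derive (cubic_primitive j) u (u ^ 3 * / common_modulus u ^ (j + 5)).
Proof.
  pose proof (common_modulus_pos u) as Hc. pose proof (pos_INR j) as Hj.
  assert (Hd : is_derive common_modulus u (u / (2 * common_modulus u))).
  { unfold common_modulus. auto_derive.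
    - pose proof (pow2_ge_0 PI). nra.
    - replace (1 + PI * (PI * 1) + u * (u * 1) * / 2) with (1 + PI ^ 2 + u ^ 2 / 2)
        by (simpl; field).
      fold (common_modulus u). field. lra. }
  assert (Hp : forall i, is_derive (fun v => / common_modulus v ^ i) u
            (- (INR i * (u / (2 * common_modulus u)) * common_modulus u ^ pred i)
             / (common_modulus u ^ i) ^ 2)).
  { intros i. apply is_derive_inv.
    - now apply is_derive_pow.
    - apply pow_nonzero. lra. }
  unfold cubic_primitive.
  evar_last.
  - apply (is_derive_minus (V := R_NormedModule));
      apply is_derive_scal; apply Hp.
  - unfold minus, plus, opp; simpl.
    replace (j + 3)%nat with (S (S (S j))) by lia.
    replace (j + 1)%nat with (S j) by lia.
    replace (j + 5)%nat with (S (S (S (S (S j))))) by lia.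
    rewrite !S_INR. cbn [pred].
    pose proof (common_modulus_sqr u) as E.
    set (r := common_modulus u) in *.
    pose proof (pow_lt r j Hc) as Hrj.
    replace (PI ^ 2) with (r ^ 2 - 1 - u ^ 2 / 2) by lra.
    replace (PI * (PI * 1)) with (r ^ 2 - 1 - u ^ 2 / 2) by lra.
    simpl. field. repeat split; lra.
Qed.

Lemma common_modulus_even (u : R) : common_modulus (- u) = common_modulus u.
Proof. unfold common_modulus. f_equal. field. Qed.

Lemma cubic_primitive_even (j : nat) (u : R) : cubic_primitive j (- u) = cubic_primitive j u.
Proof. unfold cubic_primitive. now rewrite common_modulus_even. Qed.

Lemma cubic_primitive_nonpos (j : nat) (u : R) : cubic_primitive j u <= 0.
Proof.
  pose proof (common_modulus_pos u) as Hc. pose proof (pos_INR j) as Hj.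
  pose proof (common_modulus_sqr u) as E. unfold cubic_primitive.
  replace (j + 3)%nat with (2 + (j + 1))%nat by lia. rewrite pow_add, Rinv_mult.
  pose proof (pow_lt _ (j + 1) Hc) as Hp. apply Rinv_0_lt_compat in Hp.
  assert (H2 : 0 < common_modulus u ^ 2) by (apply pow_lt, Hc).
  assert ((1 + PI ^ 2) * / common_modulus u ^ 2 <= 1).
  { apply Rmult_le_reg_r with (common_modulus u ^ 2); [exact H2|].
    rewrite Rmult_assoc, Rinv_l by lra. rewrite E. nra. }
  assert (H3 : / (INR j + 3) <= / (INR j + 1)) by (apply Rinv_le_contravar; lra).
  assert (H4 : 0 < / (INR j + 3)) by (apply Rinv_0_lt_compat; lra).
  replace (4 * (1 + PI ^ 2) / (INR j + 3) *
     (/ common_modulus u ^ 2 * / common_modulus u ^ (j + 1)) -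
     4 / (INR j + 1) * / common_modulus u ^ (j + 1))
    with (4 * / common_modulus u ^ (j + 1) *
      ((1 + PI ^ 2) * / common_modulus u ^ 2 * / (INR j + 3) - / (INR j + 1)))
    by (unfold Rdiv; ring).
  assert ((1 + PI ^ 2) * / common_modulus u ^ 2 * / (INR j + 3) - / (INR j + 1) <= 0) by nra.
  nra.
Qed.

Lemma common_modulus_0 : common_modulus 0 = rho.
Proof. unfold common_modulus, rho. f_equal. field. Qed.

Lemma cubic_primitive_0 (j : nat) :
  - cubic_primitive j 0 <= 8 / (INR j + 1) ^ 2 * / rho ^ (j + 1).
Proof.
  pose proof rho_pos as Hr. pose proof (pos_INR j) as Hj.
  unfold cubic_primitive. rewrite common_modulus_0, <- rho_sqr.
  replace (j + 3)%nat with (2 + (j + 1))%nat by lia. rewrite pow_add, Rinv_mult.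
  pose proof (pow_lt _ (j + 1) Hr) as Hp. apply Rinv_0_lt_compat in Hp.
  replace (- (4 * rho ^ 2 / (INR j + 3) * (/ rho ^ 2 * / rho ^ (j + 1)) -
     4 / (INR j + 1) * / rho ^ (j + 1)))
    with (8 / ((INR j + 1) * (INR j + 3)) * / rho ^ (j + 1)).
  - apply Rmult_le_compat_r; [lra|]. unfold Rdiv. apply Rmult_le_compat_l; [lra|].
    apply Rinv_le_contravar; nra.
  - set (x := / rho ^ (j + 1)) in *. field. repeat split; try lra.
Qed.

Lemma RInt_abs_le_primitive (f g G : R -> R) (a b : R) : a <= b ->
  (forall x, continuous f x) -> (forall x, continuous g x) ->
  (forall x, is_derive G x (g x)) -> (forall x, a <= x <= b -> Rabs (f x) <= g x) ->
  Rabs (RInt f a b) <= G b - G a.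
Proof.
  intros Hab Hf Hg HG Hfg.
  assert (E : RInt g a b = G b - G a).
  { apply is_RInt_unique. apply (is_RInt_derive G g); intros; auto. }
  rewrite <- E. eapply Rle_trans; [apply abs_RInt_le; [exact Hab | now apply ex_RInt_everywhere]|].
  apply RInt_le; trivial.
  - apply ex_RInt_everywhere. intros x. apply continuous_comp; [apply Hf | apply continuous_Rabs].
  - now apply ex_RInt_everywhere.
  - intros; apply Hfg; lra.
Qed.

(** The cubic error of the quadratic model costs one factor [1 / n] after
    multiplication by the exponent [n]: the fourth power of the width [n^(-1/2)] of the
    peak bounds the integral of [|u|^3].  The main part is of size
    [n^(-1/2) rho^(-n)], so the difference is smaller by [n^(-1/2)]. *)
Lemma kernel_moment_close (j : nat) :
  Rabs (kernel_moment (j + 5) -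
        wallis (j + 5) * (2 * PI / sqrt (2 * rho)) / rho ^ (j + 5)
        * sin (theta / 2 + INR (j + 5) * theta))
  <= 48 * INR (j + 6) / (INR j + 1) ^ 2 * / rho ^ (j + 1).
Proof.
  set (n := (j + 5)%nat).
  pose proof (sym_integral_kernel_moment n) as HK.
  destruct (c_sym_integral_model n) as [_ HM].
  set (f := fun u => 1 * Im (/ kernel u ^ S n)%C + -1 * Im (/ model u ^ S n)%C).
  assert (HfK : forall u, continuous (fun u => Im (/ kernel u ^ S n)%C) u)
    by apply c_continuous_inv_kernel_pow.
  assert (HfM : forall u, continuous (fun u => Im (/ model u ^ S n)%C) u)
    by apply c_continuous_inv_model_pow.
  pose proof (sym_integral_lin _ _ 1 (-1) _ _ HfK HfM HK HM) as Hf.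
  fold f in Hf.
  replace (kernel_moment n - wallis n * (2 * PI / sqrt (2 * rho)) / rho ^ n
        * sin (theta / 2 + INR n * theta))
    with (1 * kernel_moment n + -1 * Im (RtoC (wallis n * (2 * PI / sqrt (2 * rho)) / rho ^ n)
         * cis (theta / 2 + INR n * theta))%C)
    by (unfold cis, Im; simpl; ring).
  apply (sym_integral_abs_le _ _ _ Hf). intros N.
  pose proof (pos_INR N) as HN. pose proof (pos_INR (S n)) as Hn.
  assert (Hfc : forall u, continuous f u).
  { intros u. apply (continuous_plus (V := R_NormedModule));
      apply (continuous_scal_r (V := R_NormedModule)); auto. }
  assert (Hg : forall c u, continuous (fun u => c * (u ^ 3 * / common_modulus u ^ n)) u).
  { intros c u. apply (ex_derive_continuous (V := R_NormedModule)).
    pose proof (common_modulus_pos u) as Hc.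
    unfold common_modulus in *. auto_derive. repeat split; trivial.
    - pose proof (pow2_ge_0 PI). nra.
    - apply pow_nonzero. apply Rgt_not_eq.
      replace (1 + PI * (PI * 1) + u * (u * 1) * / 2) with (1 + PI ^ 2 + u ^ 2 / 2)
        by (simpl; field). exact Hc. }
  assert (HfB : forall u, Rabs (f u) <= 3 * INR (S n) * Rabs u ^ 3 * / common_modulus u ^ n).
  { intros u. eapply Rle_trans; [|apply Im_pow_difference_le].
    right; unfold f; f_equal; ring. }
  set (c := 3 * INR (S n)).
  assert (HG : forall d u, is_derive (fun u => d * cubic_primitive j u) u
                 (d * (u ^ 3 * / common_modulus u ^ n))).
  { intros d u. apply is_derive_scal, is_derive_cubic_primitive. }
  assert (R1 : Rabs (RInt f 0 (INR N)) <= c * cubic_primitive j (INR N) - c * cubic_primitive j 0).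
  { apply (RInt_abs_le_primitive f (fun u => c * (u ^ 3 * / common_modulus u ^ n))
             (fun u => c * cubic_primitive j u)); auto.
    intros u Hu. specialize (HfB u). rewrite (Rabs_pos_eq u) in HfB by lra.
    fold c in HfB. lra. }
  assert (R2 : Rabs (RInt f (- INR N) 0) <=
             - c * cubic_primitive j 0 - - c * cubic_primitive j (- INR N)).
  { apply (RInt_abs_le_primitive f (fun u => - c * (u ^ 3 * / common_modulus u ^ n))
             (fun u => - c * cubic_primitive j u)); auto.
    { lra. }
    intros u Hu. specialize (HfB u). rewrite (Rabs_left1 u) in HfB by lra.
    fold c in HfB. replace ((- u) ^ 3) with (- u ^ 3) in HfB by ring. lra. }
  change (Rabs (RInt f (- INR N) (INR N)) <= 48 * INR (j + 6) / (INR j + 1) ^ 2 * / rho ^ (j + 1)).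
  replace (RInt f (- INR N) (INR N)) with (RInt f (- INR N) 0 + RInt f 0 (INR N))
    by (apply (RInt_Chasles f); now apply ex_RInt_everywhere).
  eapply Rle_trans; [apply Rabs_triang|].
  rewrite cubic_primitive_even in R2.
  pose proof (cubic_primitive_nonpos j (INR N)) as H1.
  pose proof (cubic_primitive_0 j) as H2.
  replace (j + 6)%nat with (S n) by (unfold n; lia).
  replace (48 * INR (S n) / (INR j + 1) ^ 2 * / rho ^ (j + 1))
    with (2 * c * (8 / (INR j + 1) ^ 2 * / rho ^ (j + 1))) by (unfold c, Rdiv; ring).
  assert (Hc : 0 <= c) by (unfold c; lra).
  nra.
Qed.

(** * The asymptotic formula *)

Lemma Rpower_three_halves (x : R) : 0 < x -> Rpower x (3 / 2) = x * sqrt x.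
Proof.
  intros Hx. replace (3 / 2) with (1 + / 2) by field.
  now rewrite Rpower_plus, Rpower_1, Rpower_sqrt.
Qed.

Lemma Rpower_rho (x : R) : Rpower (1 + PI ^ 2) (x / 2) = Rpower rho x.
Proof.
  pose proof (pow2_ge_0 PI). unfold rho. rewrite <- Rpower_sqrt by lra.
  rewrite Rpower_mult. f_equal. field.
Qed.

Lemma W_exp_main_term_eq (m : nat) :
  W_exp_main_term (S m) =
    (-1) ^ S m * sin (theta / 2 + INR m * theta) *
    (sqrt 2 / (INR (S m) * sqrt rho * rho ^ m) * / sqrt (PI * (INR m + 1))).
Proof.
  pose proof rho_pos as Hr. pose proof PI_RGT_0 as Hpi. pose proof (pos_INR m) as Hm.
  unfold W_exp_main_term.
  replace ((2 * INR (S m) - 1) / 2 * atan PI) with (theta / 2 + INR m * theta)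
    by (rewrite S_INR; unfold theta; field).
  replace ((2 * INR (S m) - 1) / 4) with ((INR m + / 2) / 2) by (rewrite S_INR; field).
  rewrite Rpower_rho, Rpower_plus, Rpower_pow, Rpower_sqrt by exact Hr.
  rewrite <- S_INR.
  assert (HS : 0 < INR (S m)) by (rewrite S_INR; lra).
  rewrite Rpower_three_halves by exact HS.
  rewrite sqrt_div by lra. rewrite sqrt_mult by lra.
  assert (0 < sqrt PI) by now apply sqrt_lt_R0.
  assert (0 < sqrt rho) by now apply sqrt_lt_R0.
  assert (0 < sqrt (INR (S m))) by now apply sqrt_lt_R0.
  pose proof (pow_lt rho m Hr).
  field. repeat split; lra.
Qed.

(** Two errors, both smaller than the scale by a factor [n^(-1/2)]: replacing the
    kernel by its model, and replacing [wallis m] by [1 / sqrt (PI n)]. *)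
Lemma coefficient_error (a : nat -> R) (n : nat) :
  is_W_exp_expansion a -> (10 <= n)%nat ->
  Rabs (a n - W_exp_main_term n) <=
    (192 * rho ^ 5 + 4 * rho) * / sqrt (INR n) * (/ (INR n * sqrt (INR n)) * / rho ^ n).
Proof.
  intros Ha Hn.
  pose proof rho_pos as Hr. pose proof PI2_1 as Hpi. pose proof rho_sqr as Hr2.
  assert (Hr1 : 1 <= rho) by (pose proof (pow2_ge_0 PI); nra).
  set (j := (n - 6)%nat).
  assert (En : n = S (j + 5)) by (unfold j; lia).
  assert (Hj : INR n = INR j + 6) by (rewrite En, S_INR, plus_INR; simpl; ring).
  assert (HN : 10 <= INR n) by (apply (le_INR 10) in Hn; simpl in Hn; lra).
  pose proof (Lambert_coeff a n Ha ltac:(lia)) as Hc.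
  replace (pred n) with (j + 5)%nat in Hc by lia.
  pose proof (kernel_moment_close j) as H1.
  pose proof (wallis_sqrt (j + 5) ltac:(lia)) as H2.
  pose proof (W_exp_main_term_eq (j + 5)) as H3. rewrite <- En in H3.
  replace (j + 6)%nat with n in H1 by lia.
  set (m := (j + 5)%nat) in *.
  assert (Hm1 : INR m + 1 = INR n) by (rewrite En, S_INR; reflexivity).
  rewrite Hm1 in H2, H3.
  set (S0 := sin (theta / 2 + INR m * theta)) in *.
  assert (HS0 : Rabs S0 <= 1) by (apply Rabs_le_between, SIN_bound).
  set (N := INR n) in *.
  set (q := sqrt N). assert (Hq : 0 < q) by (apply sqrt_lt_R0; lra).
  assert (Hqq : q * q = N) by (apply sqrt_sqrt; lra).
  set (sg := sqrt rho) in *.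
  assert (Hsg : 1 <= sg) by (unfold sg; rewrite <- sqrt_1; apply sqrt_le_1; lra).
  assert (Hs2 : 1 <= sqrt 2 <= 2).
  { split; [rewrite <- sqrt_1; apply sqrt_le_1; lra|].
    rewrite <- (sqrt_pow2 2) at 2 by lra. apply sqrt_le_1; lra. }
  assert (Hs22 : sqrt 2 * sqrt 2 = 2) by (apply sqrt_sqrt; lra).
  assert (Hsr : sqrt (2 * rho) = sqrt 2 * sg) by (apply sqrt_mult; lra).
  pose proof (pow_lt rho n Hr) as Hrn.
  assert (Hrm : rho ^ m * rho = rho ^ n) by (rewrite En; simpl; ring).
  pose proof (pow_lt rho m Hr) as Hrm0.
  assert (Hrj : rho ^ (j + 1) * rho ^ 5 = rho ^ n).
  { rewrite <- pow_add. f_equal. lia. }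
  pose proof (pow_lt rho (j + 1) Hr) as Hrj0. pose proof (pow_lt rho 5 Hr) as Hr5.
  assert (Ea : a n = (-1) ^ n * kernel_moment m / (PI * N)).
  { apply Rmult_eq_reg_l with N; [|lra]. rewrite Hc. field. split; lra. }
  set (X := kernel_moment m - wallis m * (2 * PI / sqrt (2 * rho)) / rho ^ m * S0) in *.
  set (Y := wallis m - / sqrt (PI * N)) in *.
  assert (E : a n - W_exp_main_term n =
           (-1) ^ n * (X * / (PI * N) + S0 * (sqrt 2 / (N * sg * rho ^ m) * Y))).
  { rewrite Ea, H3. unfold X, Y. rewrite Hsr.
    set (z := / sqrt (PI * N)).
    replace (2 * PI / (sqrt 2 * sg)) with (PI * sqrt 2 / sg).
    - field. repeat split; lra.
    - apply Rmult_eq_reg_r with (sqrt 2 * sg); [|nra].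
      transitivity (PI * (sqrt 2 * sqrt 2)); [field; lra | rewrite Hs22; field; nra]. }
  rewrite E, Rabs_mult, pow_1_abs, Rmult_1_l.
  eapply Rle_trans; [apply Rabs_triang|].
  assert (B1 : Rabs (X * / (PI * N)) <= 192 * rho ^ 5 * / (N * N) * / rho ^ n).
  { rewrite Rabs_mult, (Rabs_pos_eq (/ (PI * N)))
      by (left; apply Rinv_0_lt_compat; nra).
    apply Rle_trans with (48 * N / (INR j + 1) ^ 2 * / rho ^ (j + 1) * / N).
    - apply Rmult_le_compat; [apply Rabs_pos | left; apply Rinv_0_lt_compat; nra | exact H1 |].
      apply Rinv_le_contravar; nra.
    - rewrite <- Hrj.
      replace (48 * N / (INR j + 1) ^ 2 * / rho ^ (j + 1) * / N)
        with (48 * / rho ^ (j + 1) * / ((INR j + 1) ^ 2))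
        by (field; repeat split; lra).
      replace (192 * rho ^ 5 * / (N * N) * / (rho ^ (j + 1) * rho ^ 5))
        with (48 * / rho ^ (j + 1) * / (N * N / 4))
        by (field; repeat split; lra).
      apply Rmult_le_compat_l.
      + apply Rmult_le_pos; [lra | left; now apply Rinv_0_lt_compat].
      + apply Rinv_le_contravar; nra. }
  assert (B2 : Rabs (S0 * (sqrt 2 / (N * sg * rho ^ m) * Y)) <=
            4 * rho * / (N * N * q) * / rho ^ n).
  { rewrite !Rabs_mult.
    assert (Hden : 0 < N * sg * rho ^ m) by (apply Rmult_lt_0_compat; nra).
    rewrite (Rabs_pos_eq (sqrt 2 / (N * sg * rho ^ m)))
      by (left; apply Rdiv_lt_0_compat; lra).
    apply Rle_trans with (1 * (2 * / (N * rho ^ m) * / (N / 2 * q))).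
    - apply Rmult_le_compat; trivial; try apply Rabs_pos.
      { apply Rmult_le_pos; [left; apply Rdiv_lt_0_compat; lra | apply Rabs_pos]. }
      apply Rmult_le_compat; try apply Rabs_pos.
      + left; apply Rdiv_lt_0_compat; lra.
      + apply Rmult_le_compat; try lra.
        * left; now apply Rinv_0_lt_compat.
        * apply Rinv_le_contravar; nra.
      + apply Rle_trans with (1 := H2). apply Rinv_le_contravar; fold q; nra.
    - rewrite <- Hrm. right. field. repeat split; lra. }
  replace ((192 * rho ^ 5 + 4 * rho) * / q * (/ (N * q) * / rho ^ n))
    with (192 * rho ^ 5 * / (N * N) * / rho ^ n + 4 * rho * / (N * N) * / rho ^ n).
  - apply Rplus_le_compat; [exact B1|]. apply Rle_trans with (1 := B2).
    apply Rmult_le_compat_r; [left; now apply Rinv_0_lt_compat|].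
    apply Rmult_le_compat_l; [lra|].
    assert (1 <= q) by nra.
    apply Rinv_le_contravar; nra.
  - rewrite <- Hqq. field. repeat split; lra.
Qed.

Theorem mainTheorem10 :
  forall a : nat -> R,
    is_W_exp_expansion a ->
    darboux_sim a W_exp_main_term.
Proof.
  intros a Ha eps. pose proof rho_pos as Hr.
  set (K := 192 * rho ^ 5 + 4 * rho).
  assert (HK : 0 < K) by (unfold K; pose proof (pow_lt rho 5 Hr); lra).
  assert (He : 0 < eps) by apply cond_pos.
  destruct (nfloor_ex ((K / eps) ^ 2) (pow2_ge_0 _)) as [n0 Hn0].
  exists (10 + S n0)%nat. intros n Hn.
  assert (Hn' : (K / eps) ^ 2 <= INR n).
  { assert (H : (S n0 <= n)%nat) by lia. apply le_INR in H. rewrite S_INR in H. lra. }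
  assert (Hnp : 0 < INR n) by (apply lt_0_INR; lia).
  change (Rabs (a n - W_exp_main_term n) <=
    eps * Rabs (Rpower (INR n) (- (3 / 2)) * Rpower (1 + PI ^ 2) (- (INR n / 2)))).
  rewrite !Rpower_Ropp, Rpower_rho, Rpower_pow, Rpower_three_halves by trivial.
  assert (Hq : 0 < sqrt (INR n)) by now apply sqrt_lt_R0.
  assert (Hscale : 0 < / (INR n * sqrt (INR n)) * / rho ^ n).
  { apply Rmult_lt_0_compat; apply Rinv_0_lt_compat; [nra | now apply pow_lt]. }
  rewrite (Rabs_pos_eq (_ * _)) by lra.
  eapply Rle_trans; [apply coefficient_error; [exact Ha | lia]|].
  apply Rmult_le_compat_r; [lra|]. fold K.
  assert (HKe : 0 < K / eps) by (apply Rdiv_lt_0_compat; lra).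
  assert (Hsq : K / eps <= sqrt (INR n)).
  { rewrite <- (sqrt_pow2 (K / eps)) by lra. apply sqrt_le_1_alt. exact Hn'. }
  apply Rmult_le_reg_r with (sqrt (INR n)); [exact Hq|].
  rewrite Rmult_assoc, Rinv_l, Rmult_1_r by lra.
  replace K with (eps * (K / eps)) at 1 by (field; lra).
  apply Rmult_le_compat_l; lra.
Qed.
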